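(* Let $(F,Q)$ and $(\bar F,\bar Q)$ be two pairs, each consisting of a standard driver and a terminal value in $L^2(\mathbb{R}^K;\mathcal{F}_T)$, and let $(Y,Z)$, $(\bar Y,\bar Z)\in S^2\times H^2_M$ be the solutions of the associated BSDEs. Suppose that for some $s\in[0,T]$ the following conditions hold: (i) $Q\ge\bar Q$ $\mathbb{P}$-a.s. (componentwise); (ii) $\mu\times\mathbb{P}$-a.s. on $[s,T]\times\Omega$, $F(\omega,u,\bar Y_{u-},\bar Z_u)\ge\bar F(\omega,u,\bar Y_{u-},\bar Z_u)$ (componentwise); (iii) for each $j\in\{1,\dots,K\}$ there exists a measure $\tilde{\mathbb{P}}_j$ equivalent to $\mathbb{P}$ such that the process $$e_j^*X_r:=-\int_{]s,r]}e_j^*[F(\omega,u,\bar Y_{u-},Z_u)-F(\omega,u,\bar Y_{u-},\bar Z_u)]\,d\mu_u+\sum_i\int_{]s,r]}e_j^*[Z^i_u-\bar Z^i_u]\,dM^i_u,\qquad r\in[s,T],$$ is a $\tilde{\mathbb{P}}_j$-supermartingale on $[s,T]$; (iv) the following implication holds: if for all $r\in[s,T]$ and all $i\in\{1,\dots,K\}$ $$e_i^*Y_r-E_{\tilde{\mathbb{P}}_i}\Big[\int_{]r,T]}e_i^*F(\omega,u,Y_{u-},Z_u)\,d\mu_u\Big|\mathcal{F}_r\Big]\ge e_i^*\bar Y_r-E_{\tilde{\mathbb{P}}_i}\Big[\int_{]r,T]}e_i^*F(\omega,u,\bar Y_{u-},Z_u)\,d\mu_u\Big|\mathcal{F}_r\Big],$$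 then $Y_r\ge\bar Y_r$ componentwise for all $r\in[s,T]$. Then $Y\ge\bar Y$ componentwise on $[s,T]$, except possibly on an evanescent set.
   Context: Setting: $T>0$ and $K\in\mathbb{N}$ are fixed. $(\Omega,\mathcal{F},\mathbb{P})$ is a probability space with a filtration $\{\mathcal{F}_t\}_{t\in[0,T]}$ satisfying the usual conditions, $\mathcal{F}_0$ trivial, and $L^2(\mathcal{F}_T)$ a separable Hilbert space. $M^1,M^2,\ldots$ is a fixed (finite or countable, padded by zeros) sequence of square-integrable martingales, as provided by the Davis–Varaiya martingale representation theorem: pairwise orthogonal ($\langle M^i,M^j\rangle=0$ for $i\ne j$); every square-integrable martingale $N$ can be written $N_t=N_0+\sum_i\int_{]0,t]}Z^i_u\,dM^i_u$ with predictable $Z^i$, $E[\sum_i\int_{[0,T]}(Z^i_u)^2d\langle M^i\rangle_u]<\infty$; and $\langle M^1\rangle\succ\langle M^2\rangle\succ\cdots$ (absolute continuity of each induced measure $A\mapsto E[\int_{[0,T]}I_A\,d\langle M^i\rangle]$ with respect to the preceding one). $\mathbb{R}^{K\times\infty}$ is the space of infinite sequences $z=(z^i)_{i\in\mathbb{N}}$, $z^i\in\mathbb{R}^K$; $\|\cdot\|$ is the Euclidean norm; $e_j$ is the $j$-th standard basis vector of $\mathbb{R}^K$ and $^*$ is transposition. $\mu$ is a deterministic nonnegative Stieltjes measure on $[0,T]$, positive on every nonempty open interval, identified with $\mu_t=\mu([0,t])$. With the Lebesgue decomposition $\langle M^i\rangle=m^{i,1}+m^{i,2}$ (as measures on the predictable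 $\sigma$-algebra), $m^{i,1}\ll\mu\times\mathbb{P}$, $m^{i,2}\perp\mu\times\mathbb{P}$, set $\|z_t\|^2_{M_t}:=\sum_i\|z^i_t\|^2\frac{dm^{i,1}_t}{d(\mu\times\mathbb{P})}$. $H^2_M$: predictable $\mathbb{R}^{K\times\infty}$-valued $Z$ with $E[\sum_i\int_{[0,T]}\|Z^i_t\|^2d\langle M^i\rangle_t]<\infty$. $S^2$: adapted $\mathbb{R}^K$-valued $Y$ with $E[\sup_t\|Y_t\|^2]<\infty$ (up to indistinguishability). A driver $F:\Omega\times[0,T]\times\mathbb{R}^K\times\mathbb{R}^{K\times\infty}\to\mathbb{R}^K$ is standard if it is predictable and progressively measurable, $E[\int_{]0,T]}\|F(\omega,t,0,0)\|^2d\mu_t]<\infty$, and there are $c\in\mathbb{R}$ and a deterministic measurable $c_t\le c$ with $\|F(\omega,t,y,z)-F(\omega,t,y',z')\|^2\le c_t\|y-y'\|^2+c\|z-z'\|^2_{M_t}$ $d\mu\times d\mathbb{P}$-a.s. for all $y,y',z,z'$, and $c_t(\Delta\mu_t)^2<1$ for all $t$. For standard $F$ and $Q\in L^2(\mathbb{R}^K;\mathcal{F}_T)$, the associated BSDE is $Q=Y_t-\int_{]t,T]}F(\omega,u,Y_{u-},Z_u)\,d\mu_u+\sum_{i}\int_{]t,T]}Z^i_u\,dM^i_u$, $t\in[0,T]$, which has a unique solution $(Y,Z)\in S^2\times H^2_M$. Unless otherwise indicated, (in)equalities between processes are read up to evanescence. *)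

(* Defs.v *)
From HB Require Import structures.
From mathcomp Require Export all_boot all_order all_algebra.
From mathcomp Require Export all_classical all_reals all_analysis measurable_realfun.
Export Order.TTheory GRing.Theory Num.Theory.
Export numFieldNormedType.Exports.

Set Implicit Arguments.
Unset Strict Implicit.
Unset Printing Implicit Defensive.

Local Open Scope classical_set_scope.
Local Open Scope ring_scope.

(* Conventions.
   - Time is a real number; only the values at times in [0, T] matter.
   - Vectors of R^K are row vectors 'rV[R]_K, elements of R^{K x oo} are
     functions nat -> 'rV[R]_K (the martingales are indexed from 0).
   - Objects that are only determined up to null sets (stochastic integrals,
     conditional expectations, brackets, densities) are described by a
     predicate "is a version of". *)

Definition enorm2 (R : realType) (K : nat) (v : 'rV[R]_K) : R :=
  \sum_(j < K) v 0 j ^+ 2.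

Definition meas_wrt (Omega : Type) (G : set (set Omega)) d'
    (V : measurableType d') (X : Omega -> V) : Prop :=
  forall B : set V, measurable B -> G (X @^-1` B).

Section CondExp.
Context (R : realType) (d : measure_display) (Omega : measurableType d).

Definition is_cond_exp_ge0 (Q : probability Omega R) (G : set (set Omega))
    (f g : Omega -> \bar R) : Prop :=
  [/\ forall w, (0 <= g w)%E, meas_wrt G g &
    forall A, G A -> (\int[Q]_(w in A) g w = \int[Q]_(w in A) f w)%E].

(* [g] is a version of E_Q[xi | G] = E_Q[xi^+ | G] - E_Q[xi^- | G].  No
   integrability is needed for this to make sense: where both parts are
   infinite, the library convention +oo - oo = -oo applies.  For a
   Q-integrable [xi] this is the usual conditional expectation. *)
Definition is_cond_exp (Q : probability Omega R) (G : set (set Omega))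
    (xi : Omega -> R) (g : Omega -> \bar R) : Prop :=
  exists gp gn : Omega -> \bar R,
    [/\ is_cond_exp_ge0 Q G (EFin \o xi^\+) gp,
        is_cond_exp_ge0 Q G (EFin \o xi^\-) gn &
        forall w, g w = (gp w - gn w)%E].

End CondExp.

Section Processes.
Context (R : realType) (d : measure_display) (Omega : measurableType d).
Context (P : probability Omega R) (T : R) (Ft : R -> set (set Omega)).

Record usual_filtration : Prop := UsualFiltration {
  filt_sigma : forall t, 0 <= t <= T -> sigma_algebra setT (Ft t) ;
  filt_sub : forall t, 0 <= t <= T -> Ft t `<=` measurable ;
  filt_mono : forall s t, 0 <= s -> s <= t -> t <= T -> Ft s `<=` Ft t ;
  filt_right_cont : forall t, 0 <= t < T ->
    \bigcap_(u in [set u | t < u <= T]) Ft u `<=` Ft t ;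
  filt_complete : forall A : set Omega, P.-negligible A -> Ft 0 A }.

Definition sq_integrable (X : Omega -> R) : Prop :=
  (\int[P]_w (X w ^+ 2)%:E < +oo)%E.

Definition separable_L2 : Prop :=
  exists2 f : nat -> Omega -> R,
    forall n, meas_wrt (Ft T) (f n) /\ sq_integrable (f n) &
    forall X : Omega -> R, meas_wrt (Ft T) X -> sq_integrable X ->
    forall e : R, 0 < e -> exists n,
      (\int[P]_w ((X w - f n w) ^+ 2)%:E < e%:E)%E.

Definition adapted (X : R -> Omega -> R) : Prop :=
  forall t, 0 <= t <= T -> meas_wrt (Ft t) (X t).

Definition cadlag (f : R -> R) : Prop :=
  (forall t, 0 <= t < T -> f u @[u --> t^'+] --> f t) /\
  (forall t, 0 < t <= T -> cvg (f u @[u --> t^'-])).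

Definition martingale (X : R -> Omega -> R) : Prop :=
  [/\ adapted X,
      {ae P, forall w, cadlag (X ^~ w)},
      (forall t, 0 <= t <= T -> P.-integrable setT (EFin \o X t)) &
      forall r t A, 0 <= r -> r <= t -> t <= T -> Ft r A ->
        (\int[P]_(w in A) (X t w)%:E = \int[P]_(w in A) (X r w)%:E)%E].

Definition sq_martingale (X : R -> Omega -> R) : Prop :=
  martingale X /\ forall t, 0 <= t <= T -> sq_integrable (X t).

(* Supermartingale on [s, T] for a probability Q, possibly different from P. *)
Definition supermartingale_on (Q : probability Omega R) (s : R)
    (X : R -> Omega -> R) : Prop :=
  [/\ (forall t, s <= t <= T -> meas_wrt (Ft t) (X t)),
      (forall t, s <= t <= T -> Q.-integrable setT (EFin \o X t)) &
      forall r t A, s <= r -> r <= t -> t <= T -> Ft r A ->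
        (\int[Q]_(w in A) (X t w)%:E <= \int[Q]_(w in A) (X r w)%:E)%E].

(* The predictable sigma-algebra, on pairs (time, outcome). *)
Definition pred_gen : set (set (measurableTypeR R * Omega)) :=
  [set C | (exists2 A, Ft 0 A & C = [set 0] `*` A) \/
           (exists u v A, [/\ 0 <= u, u <= v, v <= T, Ft u A &
                              C = `]u, v]%classic `*` A])].

Definition pred_type := g_sigma_algebraType pred_gen.

Definition time_space : set (measurableTypeR R * Omega) :=
  `[0, T]%classic `*` setT.

Definition predictable (H : R -> Omega -> R) : Prop :=
  measurable_fun (time_space : set pred_type)
    ((fun x => H x.1 x.2) : pred_type -> R).

(* [V] is the predictable covariation <M, N>, normalised by V_0 = 0. *)
Definition is_covariation (M N V : R -> Omega -> R) : Prop :=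
  [/\ predictable V,
      forall w, bounded_variation 0 T (V ^~ w),
      forall w, V 0 w = 0 &
      martingale (fun t w => M t w * N t w - V t w)].

(* <M>, with a version all of whose paths are nondecreasing and
   right-continuous, extended by 0 to negative times: the path measure
   d<M>(w) is then [lebesgue_stieltjes_measure (A w)], without mass at 0. *)
Definition is_bracket (M : R -> Omega -> R) (A : Omega -> cumulative R R)
    : Prop :=
  is_covariation M M (fun t w => A w t) /\ (forall w t, t <= 0 -> A w t = 0).

Definition bracket_measure (A : Omega -> cumulative R R) (C : set pred_type)
    : \bar R :=
  (\int[P]_w \int[lebesgue_stieltjes_measure (A w)]_(t in `[0%R, T])
     (\1_C (t, w))%:E)%E.

(* sum_k coef_k 1_{]lo_k, hi_k]} *)
Record simple_integrand := SimpleIntegrand {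
  s_size : nat ;
  s_lo : 'I_s_size -> R ;
  s_hi : 'I_s_size -> R ;
  s_coef : 'I_s_size -> Omega -> R }.

Definition simple_predictable (S : simple_integrand) : Prop :=
  forall k : 'I_(s_size S),
  [/\ 0 <= s_lo k, s_lo k <= s_hi k, s_hi k <= T,
      meas_wrt (Ft (s_lo k)) (s_coef k) &
      exists c : R, forall w, `|s_coef k w| <= c].

Definition simple_val (S : simple_integrand) (t : R) (w : Omega) : R :=
  \sum_(k < s_size S)
    s_coef k w * \1_(`]s_lo k, s_hi k]%classic : set R) t.

Definition simple_int (S : simple_integrand) (M : R -> Omega -> R)
    (t : R) (w : Omega) : R :=
  \sum_(k < s_size S)
    s_coef k w * (M (Num.min t (s_hi k)) w - M (Num.min t (s_lo k)) w).

(* [N] is a version of the Ito integral t |-> int_{]0,t]} H dM, where A = <M>: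
   the L^2 limit of the integrals of simple integrands converging to H in
   L^2(d<M> x dP). *)
Definition is_stoch_int (M : R -> Omega -> R) (A : Omega -> cumulative R R)
    (H N : R -> Omega -> R) : Prop :=
  [/\ predictable H, adapted N, {ae P, forall w, cadlag (N ^~ w)} &
    exists S : nat -> simple_integrand,
    [/\ forall n, simple_predictable (S n),
        (\int[P]_w \int[lebesgue_stieltjes_measure (A w)]_(t in `]0%R, T])
           ((simple_val (S n) t w - H t w) ^+ 2)%:E)%E @[n --> \oo] --> 0%E &
        forall t, 0 <= t <= T ->
        (\int[P]_w ((simple_int (S n) M t w - N t w) ^+ 2)%:E)%E
          @[n --> \oo] --> 0%E]].

(* [N] is a version of t |-> sum_i int_{]0,t]} H^i dM^i (sum in L^2). *)
Definition is_stoch_int_sum (M : nat -> R -> Omega -> R)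
    (A : nat -> Omega -> cumulative R R)
    (H : nat -> R -> Omega -> R) (N : R -> Omega -> R) : Prop :=
  [/\ adapted N, {ae P, forall w, cadlag (N ^~ w)} &
    exists Ni : nat -> R -> Omega -> R,
      (forall i, is_stoch_int (M i) (A i) (H i) (Ni i)) /\
      (forall t, 0 <= t <= T ->
        (\int[P]_w ((\sum_(i < n) Ni i t w - N t w) ^+ 2)%:E)%E
          @[n --> \oo] --> 0%E)].

Definition H2_M (A : nat -> Omega -> cumulative R R) (K : nat)
    (Z : nat -> R -> Omega -> 'rV[R]_K) : Prop :=
  (forall i j, predictable (fun t w => Z i t w 0 j)) /\
  (\int[P]_w (\sum_(0 <= i <oo)
     \int[lebesgue_stieltjes_measure (A i w)]_(t in `[0%R, T])
       (enorm2 (Z i t w))%:E) < +oo)%E.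

Definition S2 (K : nat) (Y : R -> Omega -> 'rV[R]_K) : Prop :=
  [/\ forall j, adapted (fun t w => Y t w 0 j),
      {ae P, forall w, forall j, cadlag (fun t => Y t w 0 j)} &
      (\int[P]_w ereal_sup [set (enorm2 (Y t w))%:E | t in `[0%R, T]]
         < +oo)%E].

(* Y_{t-}, with Y_{0-} := Y_0. *)
Definition left_lim (K : nat) (Y : R -> Omega -> 'rV[R]_K) (t : R) (w : Omega)
    : 'rV[R]_K :=
  \row_j (if t <= 0 then Y 0 w 0 j else lim (Y u w 0 j @[u --> t^'-])).

(* The Davis-Varaiya property; M lists the martingales, padded by zeros. *)
Definition representation_property (M : nat -> R -> Omega -> R)
    (A : nat -> Omega -> cumulative R R) : Prop :=
  forall N : R -> Omega -> R, sq_martingale N ->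
  exists (Z : nat -> R -> Omega -> R) (J : R -> Omega -> R),
  [/\ forall i, predictable (Z i),
      (\int[P]_w (\sum_(0 <= i <oo)
         \int[lebesgue_stieltjes_measure (A i w)]_(t in `[0%R, T])
           (Z i t w ^+ 2)%:E) < +oo)%E,
      is_stoch_int_sum M A Z J &
      {ae P, forall w, forall t, 0 <= t <= T -> N t w = N 0 w + J t w}].

Context (mu : {finite_measure set (measurableTypeR R) -> \bar R}).

(* Lebesgue decomposition d<M> = m1 + m2 on the predictable sigma-algebra,
   m1 << mu x P, m2 _|_ mu x P, and [h] is a version of dm1 / d(mu x P). *)
Definition is_bracket_density (A : Omega -> cumulative R R)
    (h : R -> Omega -> R) : Prop :=
  exists m1 m2 : {measure set pred_type -> \bar R},
  [/\ forall C : set pred_type, measurable C ->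
        bracket_measure A C = (m1 C + m2 C)%E,
      m1 `<< ((mu \x P)%E : set pred_type -> \bar R),
      (exists C : set pred_type,
         [/\ measurable C, (mu \x P)%E C = 0%E & m2 (~` C) = 0%E]) &
      [/\ predictable h, forall t w, 0 <= h t w &
          forall C : set pred_type, measurable C -> C `<=` time_space ->
            m1 C = (\int[(mu \x P)%E]_(x in C) (h x.1 x.2)%:E)%E]].

Record bsde_setting (M : nat -> R -> Omega -> R)
    (A : nat -> Omega -> cumulative R R) (h : nat -> R -> Omega -> R)
    : Prop := BsdeSetting {
  T_gt0 : 0 < T ;
  filtP : usual_filtration ;
  F0_trivial : forall B, Ft 0 B -> P B = 0%E \/ P B = 1%E ;
  L2_separable : separable_L2 ;
  M_martingale : forall i, sq_martingale (M i) ;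
  M_bracket : forall i, is_bracket (M i) (A i) ;
  M_orthogonal : forall i j, i != j ->
    is_covariation (M i) (M j) (fun _ _ => 0) ;
  M_representation : representation_property M A ;
  M_decreasing : forall i, bracket_measure (A i.+1) `<< bracket_measure (A i) ;
  mu_support : mu (~` `[0, T]%classic) = 0%E ;
  mu_pos : forall a b, 0 <= a -> a < b -> b <= T ->
    (0 < mu `]a, b[%classic)%E ;
  h_density : forall i, is_bracket_density (A i) (h i) }.

(* ||z||^2_{M_t}, given versions h i of dm^{i,1} / d(mu x P). *)
Definition znorm2 (h : nat -> R -> Omega -> R) (K : nat) (t : R) (w : Omega)
    (z : nat -> 'rV[R]_K) : \bar R :=
  (\sum_(0 <= i <oo) (enorm2 (z i) * h i t w)%:E)%E.

Definition driver (K : nat) : Type :=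
  Omega -> R -> 'rV[R]_K -> (nat -> 'rV[R]_K) -> 'rV[R]_K.

(* Generators of (sigma-algebra generated by G) (x) Borel(R^K) (x)
   Borel(R^{K x oo}). *)
Definition driver_args (K : nat) : Type :=
  ((R * Omega) * ('rV[R]_K * (nat -> 'rV[R]_K)))%type.

Definition joint_gen (K : nat) (G : set (set (R * Omega)))
    : set (set (driver_args K)) :=
  [set C | [\/ exists2 B, G B & C = [set x : driver_args K | B x.1],
               exists (j : 'I_K) (B : set R), measurable B /\
                 C = [set x : driver_args K | B (x.2.1 0 j)] |
               exists (i : nat) (j : 'I_K) (B : set R), measurable B /\
                 C = [set x : driver_args K | B (x.2.2 i 0 j)]]].

Definition joint_measurable (K : nat) (G : set (set (R * Omega)))
    (D : set (R * Omega)) (F : driver K) : Prop :=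
  forall (j : 'I_K) (B : set R), measurable B ->
    <<s joint_gen G >>
      [set x : driver_args K | D x.1 /\ B (F x.1.2 x.1.1 x.2.1 x.2.2 0 j)].

Definition predictable_driver (K : nat) (F : driver K) : Prop :=
  joint_measurable pred_gen time_space F.

Definition progressive_driver (K : nat) (F : driver K) : Prop :=
  forall t, 0 <= t <= T ->
    joint_measurable
      [set C | exists (I : set R) (B : set Omega),
         [/\ measurable I, I `<=` `[0, t]%classic, Ft t B & C = I `*` B]]
      (`[0, t]%classic `*` setT) F.

Record standard_driver (h : nat -> R -> Omega -> R) (K : nat) (F : driver K)
    : Prop := StandardDriver {
  F_predictable : predictable_driver F ;
  F_progressive : progressive_driver F ;
  F_sq_integrable :
    (\int[P]_w \int[mu]_(t in `]0%R, T])
       (enorm2 (F w t 0 (fun _ => 0)))%:E < +oo)%E ;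
  F_lipschitz : exists (c : R) (ct : R -> R),
    [/\ measurable_fun (`[0, T]%classic : set R) ct,
        forall t, 0 <= t <= T -> ct t <= c,
        forall t, 0 <= t <= T -> ct t * fine (mu [set t]) ^+ 2 < 1 &
        {ae (mu \x P)%E, forall x, 0 <= x.1 <= T ->
          forall (y y' : 'rV[R]_K) (z z' : nat -> 'rV[R]_K),
          ((enorm2 (F x.2 x.1 y z - F x.2 x.1 y' z'))%:E <=
             (ct x.1 * enorm2 (y - y'))%:E
             + c%:E * znorm2 h x.1 x.2 (fun i => z i - z' i)%R)%E}] }.

Definition terminal_value (K : nat) (Q : Omega -> 'rV[R]_K) : Prop :=
  (forall j, meas_wrt (Ft T) (fun w => Q w 0 j)) /\
  (\int[P]_w (enorm2 (Q w))%:E < +oo)%E.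

(* (Y, Z) in S^2 x H^2_M solves the BSDE with data (F, Q); J j is the j-th
   component of t |-> sum_i int_{]0,t]} Z^i dM^i. *)
Definition bsde_solution (M : nat -> R -> Omega -> R)
    (A : nat -> Omega -> cumulative R R) (K : nat) (F : driver K)
    (Q : Omega -> 'rV[R]_K) (Y : R -> Omega -> 'rV[R]_K)
    (Z : nat -> R -> Omega -> 'rV[R]_K) : Prop :=
  [/\ S2 Y, H2_M A Z &
    exists J : 'I_K -> R -> Omega -> R,
      (forall j, is_stoch_int_sum M A (fun i t w => Z i t w 0 j) (J j)) /\
      {ae P, forall w, forall t, 0 <= t <= T -> forall j,
        Q w 0 j = Y t w 0 j
          - (\int[mu]_(u in `]t, T])
               (F w u (left_lim Y u w) (fun i => Z i u w) 0 j))
          + (J j T w - J j t w)}].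

End Processes.

(* Main.v *)
(* For fixed r and component j, put delta = X_T - X_r.  Subtracting the two
   equations between r and T gives, almost surely,
     Yb_r - int_r^T F(Yb_-, Z) dmu - delta <= Y_r - int_r^T F(Y_-, Z) dmu,
   because Q >= Qb and F(Yb_-, Zb) >= Fb(Yb_-, Zb); conditioning under Pt_j,
   where delta has nonpositive conditional mean, yields the premise of (iv).
   The path integrals need not be Pt_j-integrable, so positive and negative
   parts are moved across the inequality before conditioning, and the infinite
   values of the conditional expectations are treated separately.  Subtracting
   the equations requires u |-> F(., u, Y_-, Z) to be mu-integrable along almost
   every path; this follows from the Lipschitz bound, since cadlag paths are
   bounded and the part of d<M^i> that is absolutely continuous with respect to
   mu x P is at most d<M^i>, so that int |Z|^2_M dmu is almost surely finite. *)
From HB Require Import structures.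
From mathcomp Require Import ring lra.
Require Import Defs.

Set Implicit Arguments.
Unset Strict Implicit.
Unset Printing Implicit Defensive.

Local Open Scope classical_set_scope.
Local Open Scope ring_scope.

(** * Conditional expectations *)

(** Condition (iii) speaks of versions of the stochastic integral of [Z - Zb], whereas the two
    equations supply separate integrals of [Z] and of [Zb]. Linearity of the L^2 limits closes this
    gap. It rests on (f - g)^2 <= 2 f^2 + 2 g^2 under the iterated integral of d<M>(w) and P(dw),
    and splitting the outer integral requires the inner Stieltjes integral to be measurable in w;
    this is why w |-> d<M>(w) is treated as a kernel. The inequality between h d(mu x P) and d<M> is
    given on predictable sets only, so it reaches functions through predictable simple functions.
    The inequality between the paths holds P-almost surely while conditioning takes place under
    [Pt j]: both directions of the equivalence of the two measures are used. *)

Section SubSigmaAlgebra.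
Context (R : realType) (d : measure_display) (Omega : measurableType d).
Context (G : set (set Omega)) (sG : sigma_algebra setT G).

Local Notation OG := (g_sigma_algebraType G).

Lemma measurable_sigma_algebraE (C : set Omega) :
  measurable (C : set OG) = G C.
Proof. by rewrite -[in RHS](sigma_algebra_id sG). Qed.

(** Since [G] is already a sigma-algebra, passing to the measurable type that it generates adds no
    sets. The usual closure properties of measurable functions thereby become available for
    [meas_wrt G]. *)
Lemma meas_wrt_measurable_fun d' (V : measurableType d') (X : Omega -> V) :
  meas_wrt G X <-> measurable_fun (setT : set OG) (X : OG -> V).
Proof.
split => [mX _ B mB|mX B mB].
  by rewrite setTI measurable_sigma_algebraE; exact: mX.
by have := mX measurableT B mB; rewrite setTI measurable_sigma_algebraE.
Qed.

Lemma meas_wrt_sub d' (V : measurableType d') (X : Omega -> V) :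
  G `<=` measurable -> meas_wrt G X -> measurable_fun setT X.
Proof. by move=> GM mX _ B mB; rewrite setTI; exact/GM/mX. Qed.

End SubSigmaAlgebra.

Section CondExpComparison.
Context (R : realType) (d : measure_display) (Omega : measurableType d).
Context (Q : probability Omega R) (G : set (set Omega)).
Hypothesis sG : sigma_algebra setT G.
Hypothesis GM : G `<=` measurable.

Local Open Scope ereal_scope.

(** The set where V < U is exhausted by the sets [B k], on which V is at most k and U exceeds V by
    at least 1/(k+1). The cap makes the integral of V over [B k] finite, so it can be cancelled, and
    the gap then forces [B k] to be null. Values +oo of U are allowed. *)
Lemma ae_le_of_integral_le (U V : Omega -> \bar R) :
  (forall w, 0 <= U w) -> (forall w, 0 <= V w) ->
  meas_wrt G U -> meas_wrt G V ->
  (forall A, G A -> \int[Q]_(w in A) U w <= \int[Q]_(w in A) V w) ->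
  {ae Q, forall w, U w <= V w}.
Proof.
move=> U0 V0 mU mV UV.
have mU' := meas_wrt_sub GM mU; have mV' := meas_wrt_sub GM mV.
pose B k := [set w | V w <= k%:R%:E /\ V w + k.+1%:R^-1%:E <= U w].
have GB k : G (B k).
  rewrite -(measurable_sigma_algebraE sG).
  have mUG := (meas_wrt_measurable_fun sG U).1 mU.
  have mVG := (meas_wrt_measurable_fun sG V).1 mV.
  rewrite (_ : B k = (setT `&` [set w | V w <= k%:R%:E]) `&`
    (setT `&` [set w | V w + k.+1%:R^-1%:E <= U w])); last first.
    by rewrite !setTI.
  apply: measurableI.
    by apply: (@measurable_lee _ (g_sigma_algebraType G)) => //; exact: measurable_cst.
  apply: (@measurable_lee _ (g_sigma_algebraType G)) => //.
  apply: emeasurable_funD => //; exact: measurable_cst.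
have mB k : measurable (B k) by exact: GM.
have QB k : Q (B k) = 0.
  apply/eqP; rewrite eq_le measure_ge0 andbT leNgt; apply/negP => QB0.
  have Vfin : \int[Q]_(w in B k) V w < +oo.
    apply: (@le_lt_trans _ _ (\int[Q]_(w in B k) (cst k%:R%:E w))).
      by apply: ge0_le_integral => //; [exact: measurable_funTS|move=> w []].
    rewrite integral_cst//; apply: lte_mul_pinfty => //.
    by rewrite (le_lt_trans (probability_le1 Q (mB k))) ?ltey.
  have : \int[Q]_(w in B k) (V w + cst k.+1%:R^-1%:E w) <=
      \int[Q]_(w in B k) V w.
    apply: le_trans (UV _ (GB k)); apply: ge0_le_integral => //.
    - by move=> w _; rewrite adde_ge0// lee_fin invr_ge0.
    - by apply: emeasurable_funD => //; exact: measurable_funTS.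
    - exact: measurable_funTS.
    - by move=> w [].
  rewrite ge0_integralD//; last 2 first.
  - exact: measurable_funTS.
  - by move=> w _; rewrite lee_fin invr_ge0.
  rewrite integral_cst// leNgt => /negP; apply.
  rewrite lteDl.
    by rewrite mule_gt0// lte_fin invr_gt0.
  by rewrite ge0_fin_numE// integral_ge0.
suff : Q.-negligible (\bigcup_k B k).
  apply: negligibleS => w /= /negP; rewrite -ltNge => VU.
  have [v0 Vv] : exists v, V w = v%:E.
    by exists (fine (V w)); rewrite fineK// ge0_fin_numE// (lt_le_trans VU)// leey.
  have [e [e0 Ve]] : exists e : R, (0 < e)%R /\ V w + e%:E <= U w.
    move: VU; rewrite Vv; case: (U w) => [u||]// VU.
      exists (u - v0)%R; rewrite subr_gt0 -lte_fin; split => //.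
      by rewrite -EFinD lee_fin addrC subrK.
    by exists 1%R; rewrite leey.
  pose n := Num.bound e^-1; pose m := Num.bound v0.
  exists (maxn n m) => //; split.
    have v00 : (0 <= v0)%R by have := V0 w; rewrite Vv lee_fin.
    rewrite Vv lee_fin ltW// (lt_le_trans (archi_boundP v00))// ler_nat.
    exact: leq_maxr.
  apply: le_trans Ve; rewrite leeD2l// lee_fin invf_ple ?posrE//.
  rewrite ltW// (lt_le_trans (archi_boundP _)) ?invr_ge0 ?ltW//.
  by rewrite ltr_nat ltnS leq_maxl.
by apply: negligible_bigcup => k; exists (B k); split=> //; exact: QB.
Qed.

(** On a non-null set where V is bounded and U is infinite, the left integral would be +oo and the
    right one finite. The term D need not be measurable with respect to [G]; only its total integral
    matters. *)
Lemma ae_lty_of_integral_le (U V : Omega -> \bar R) (D : Omega -> \bar R) :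
  (forall w, 0 <= U w) -> (forall w, 0 <= V w) -> (forall w, 0 <= D w) ->
  meas_wrt G U -> meas_wrt G V -> measurable_fun setT D ->
  \int[Q]_w D w < +oo ->
  (forall A, G A -> \int[Q]_(w in A) U w <=
    \int[Q]_(w in A) V w + \int[Q]_(w in A) D w) ->
  {ae Q, forall w, V w < +oo -> U w < +oo}.
Proof.
move=> U0 V0 D0 mU mV mD Dfin UV.
have mU' := meas_wrt_sub GM mU; have mV' := meas_wrt_sub GM mV.
pose B k := [set w | V w <= k%:R%:E /\ U w = +oo].
have GB k : G (B k).
  rewrite -(measurable_sigma_algebraE sG).
  have mUG := (meas_wrt_measurable_fun sG U).1 mU.
  have mVG := (meas_wrt_measurable_fun sG V).1 mV.
  rewrite (_ : B k = (setT `&` [set w | V w <= k%:R%:E]) `&`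
    (setT `&` [set w | +oo <= U w])); last first.
    rewrite !setTI; apply/seteqP; split => w /= [Vk].
      by move=> ->.
    by rewrite leye_eq => /eqP.
  apply: measurableI.
    by apply: (@measurable_lee _ (g_sigma_algebraType G)) => //; exact: measurable_cst.
  by apply: (@measurable_lee _ (g_sigma_algebraType G)) => //; exact: measurable_cst.
have mB k : measurable (B k) by exact: GM.
have QB k : Q (B k) = 0.
  apply/eqP; rewrite eq_le measure_ge0 andbT leNgt; apply/negP => QB0.
  have Vfin : \int[Q]_(w in B k) V w < +oo.
    apply: (@le_lt_trans _ _ (\int[Q]_(w in B k) (cst k%:R%:E w))).
      by apply: ge0_le_integral => //; [exact: measurable_funTS|move=> w []].
    rewrite integral_cst//; apply: lte_mul_pinfty => //.
    by rewrite (le_lt_trans (probability_le1 Q (mB k))) ?ltey.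
  have DBfin : \int[Q]_(w in B k) D w < +oo.
    apply: le_lt_trans Dfin; exact: ge0_subset_integral.
  have := UV _ (GB k).
  rewrite (_ : \int[Q]_(w in B k) U w = +oo); last first.
    rewrite (@eq_integral _ _ _ _ _ (cst +oo)); last by move=> w /set_mem[].
    by rewrite integral_cst// gt0_mulye.
  rewrite leye_eq => /eqP; have := lte_add_pinfty Vfin DBfin.
  by move=> /[swap] ->.
suff : Q.-negligible (\bigcup_k B k).
  apply: negligibleS => w /= /not_implyP[Vw]; rewrite ltNge => /negP.
  rewrite negbK leye_eq => /eqP Uw.
  exists (Num.bound (fine (V w))) => //; split => //.
  rewrite -(@fineK _ (V w)) ?ge0_fin_numE// lee_fin.
  by rewrite ltW// archi_boundP// fine_ge0.
by apply: negligible_bigcup => k; exists (B k); split=> //; exact: QB.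
Qed.

Let integralD4 (A : set Omega) (f g h k : Omega -> R) : measurable A ->
  measurable_fun setT f -> measurable_fun setT g -> measurable_fun setT h ->
  measurable_fun setT k ->
  (forall w, (0 <= f w)%R) -> (forall w, (0 <= g w)%R) ->
  (forall w, (0 <= h w)%R) -> (forall w, (0 <= k w)%R) ->
  \int[Q]_(w in A) (f w + g w + h w + k w)%:E =
  \int[Q]_(w in A) (f w)%:E + \int[Q]_(w in A) (g w)%:E +
  \int[Q]_(w in A) (h w)%:E + \int[Q]_(w in A) (k w)%:E.
Proof.
move=> mA mf mg mh mk f0 g0 h0 k0.
have mE (l : Omega -> R) : measurable_fun setT l ->
    measurable_fun A (fun w => (l w)%:E).
  by move=> ml; apply/measurable_EFinP; exact: measurable_funTS.
have mE2 : measurable_fun A (fun w => (f w)%:E + (g w)%:E).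
  by apply: emeasurable_funD; exact: mE.
have mE3 : measurable_fun A (fun w => (f w)%:E + (g w)%:E + (h w)%:E).
  by apply: emeasurable_funD => //; exact: mE.
under eq_integral do rewrite !EFinD.
rewrite !ge0_integralD//; try exact: mE.
- by move=> w _; rewrite lee_fin.
- by move=> w _; rewrite lee_fin.
- by move=> w _; rewrite adde_ge0// lee_fin.
- by move=> w _; rewrite lee_fin.
- by move=> w _; rewrite !adde_ge0// lee_fin.
- by move=> w _; rewrite lee_fin.
Qed.

(** Neither [xi] nor [xib] is assumed integrable, so E and Eb may be infinite and cannot be
    subtracted. Everything is therefore stated for the nonnegative parts gp, gn, gpb, gnb and for a
    = y - yb, and the differences are formed only at the end. *)
Lemma cond_exp_comparison (xi xib y yb delta : Omega -> R)
    (E Eb : Omega -> \bar R) :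
  measurable_fun setT xi -> measurable_fun setT xib ->
  meas_wrt G y -> meas_wrt G yb ->
  Q.-integrable setT (EFin \o delta) ->
  (forall A, G A -> \int[Q]_(w in A) (delta w)%:E <= 0) ->
  {ae Q, forall w, (yb w - xib w - delta w <= y w - xi w)%R} ->
  is_cond_exp Q G xi E -> is_cond_exp Q G xib Eb ->
  {ae Q, forall w, (yb w)%:E - Eb w <= (y w)%:E - E w}.
Proof.
move=> mxi mxib my myb idelta delta0 le_ae [gp [gn [[gp0 mgp gpE] [gn0 mgn gnE] EE]]].
move=> [gpb [gnb [[gpb0 mgpb gpbE] [gnb0 mgnb gnbE] EbE]]].
pose a w := (y w - yb w)%R.
have ma : meas_wrt G a.
  apply/(meas_wrt_measurable_fun sG); apply: measurable_funB.
    exact/(meas_wrt_measurable_fun sG).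
  exact/(meas_wrt_measurable_fun sG).
have mapos : meas_wrt G a^\+%R.
  apply/(meas_wrt_measurable_fun sG)/measurable_funrpos.
  exact/(meas_wrt_measurable_fun sG).
have maneg : meas_wrt G a^\-%R.
  apply/(meas_wrt_measurable_fun sG)/measurable_funrneg.
  exact/(meas_wrt_measurable_fun sG).
have mdelta : measurable_fun setT delta.
  by apply/measurable_EFinP; exact: measurable_int idelta.
have posneg (f : Omega -> R) w : f w = (f^\+ w - f^\- w)%R.
  by rewrite -[in LHS](funrposBneg f).
have mpos (f : Omega -> R) : measurable_fun setT f ->
  measurable_fun setT f^\+%R by exact: measurable_funrpos.
have mneg (f : Omega -> R) : measurable_fun setT f ->
  measurable_fun setT f^\-%R by exact: measurable_funrneg.
have mGT (f : Omega -> R) : meas_wrt G f -> measurable_fun setT f.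
  exact: meas_wrt_sub.
have mGE (f : Omega -> R) : meas_wrt G f -> meas_wrt G (EFin \o f).
  move=> mf; apply/(meas_wrt_measurable_fun sG)/measurable_EFinP.
  exact/(meas_wrt_measurable_fun sG).
have mGD (f g : Omega -> \bar R) : meas_wrt G f -> meas_wrt G g ->
    meas_wrt G (fun w => f w + g w).
  move=> mf mg; apply/(meas_wrt_measurable_fun sG)/emeasurable_funD.
    exact/(meas_wrt_measurable_fun sG).
  exact/(meas_wrt_measurable_fun sG).
(* The pathwise inequality reads xi - xib <= a + delta. With all negative parts moved to the other
   side it becomes an inequality between sums of nonnegative functions, which can be integrated over
   any A in [G]. The contribution of delta drops out because the integral of its positive part over
   A is at most that of its negative part, which is finite. *)
have step1 : {ae Q, forall w, gp w + gnb w + (a^\- w)%:E <=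
    gpb w + gn w + (a^\+ w)%:E}.
  apply: ae_le_of_integral_le.
  - by move=> w; rewrite !adde_ge0// lee_fin.
  - by move=> w; rewrite !adde_ge0// lee_fin.
  - by apply: (mGD (fun w => gp w + gnb w)); [exact: mGD|exact: mGE].
  - by apply: (mGD (fun w => gpb w + gn w)); [exact: mGD|exact: mGE].
  move=> A GA; have mA := GM GA.
  have mI (f : Omega -> \bar R) : meas_wrt G f -> measurable_fun A f.
    by move=> mf; apply: measurable_funTS; exact: meas_wrt_sub mf.
  have ID3 (f g : Omega -> \bar R) (h : Omega -> R) :
      meas_wrt G f -> meas_wrt G g -> meas_wrt G h ->
      (forall w, 0 <= f w) -> (forall w, 0 <= g w) -> (forall w, 0 <= h w)%R ->
      \int[Q]_(w in A) (f w + g w + (h w)%:E) =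
      \int[Q]_(w in A) f w + \int[Q]_(w in A) g w + \int[Q]_(w in A) (h w)%:E.
    move=> mf mg mh f0 g0 h0; rewrite ge0_integralD//.
    - by rewrite ge0_integralD//; exact: mI.
    - by move=> w _; rewrite adde_ge0.
    - by apply: mI; exact: mGD.
    - by move=> w _; rewrite lee_fin.
    - by apply: (mI (EFin \o h)); exact: mGE.
  rewrite ID3// ID3// gpE// gnbE// gpbE// gnE//.
  have dI : \int[Q]_(w in A) (delta^\+ w)%:E <= \int[Q]_(w in A) (delta^\- w)%:E
     /\ \int[Q]_(w in A) (delta^\- w)%:E < +oo.
    have iA : Q.-integrable A (EFin \o delta).
      exact: integrableS idelta.
    have : \int[Q]_(w in A) (EFin \o delta) w <= 0 by exact: delta0.
    rewrite integralE.
    have := integrable_neg_fin_num mA iA; have := integrable_pos_fin_num mA iA.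
    rewrite funerpos funerneg => fp fn.
    rewrite leeBlDr// add0e => ->; split => //.
    by move: fn; rewrite ge0_fin_numE// integral_ge0// => w _; rewrite lee_fin.
  have [dI1 dI2] := dI.
  have dfin : \int[Q]_(w in A) (delta^\- w)%:E \is a fin_num.
    by rewrite ge0_fin_numE// integral_ge0// => w _; rewrite lee_fin.
  rewrite -(leeD2rE _ _ dfin).
  have : \int[Q]_(w in A) (xi^\+ w + xib^\- w + a^\- w + delta^\- w)%:E <=
     \int[Q]_(w in A) (xib^\+ w + xi^\- w + a^\+ w + delta^\+ w)%:E.
    apply: ae_ge0_le_integral => //.
    - by move=> w _; rewrite lee_fin !addr_ge0.
    - apply/measurable_EFinP; apply: measurable_funTS.
      by do 3! (apply: measurable_funD; last by [exact: mneg|exact: mGT]) => //;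
        exact: mpos.
    - by move=> w _; rewrite lee_fin !addr_ge0.
    - apply/measurable_EFinP; apply: measurable_funTS.
      apply: measurable_funD; last exact: mpos.
      apply: measurable_funD; last exact: mGT.
      by apply: measurable_funD; [exact: mpos|exact: mneg].
    - apply: filterS le_ae => w le_w _; rewrite lee_fin.
      have := le_w; rewrite (posneg xi) (posneg xib) (posneg delta).
      have := posneg a w; rewrite {1}/a; lra.
  rewrite !integralD4//; do ?[exact: mpos|exact: mneg|exact: mGT].
  by move=> /le_trans; apply; rewrite leeD2l.
(* This follows from xib^- <= xi^- + a^+ + delta^+ with delta^+ integrable. It is needed because
   [step1] says nothing when both of its sides are +oo: gpb = gnb = +oo with gn finite would give Eb
   = -oo by convention and break the conclusion. *)
have step2 : {ae Q, forall w, gn w + (a^\+ w)%:E < +oo -> gnb w < +oo}.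
  apply: (@ae_lty_of_integral_le _ _ (EFin \o delta^\+%R)) => //.
  - by move=> w; rewrite adde_ge0// lee_fin.
  - by move=> w; rewrite lee_fin.
  - by apply: mGD; [|exact: mGE].
  - by apply/measurable_EFinP; exact: mpos.
  - by have := integral_funepos_lt_pinfty measurableT idelta; rewrite funerpos.
  move=> A GA; have mA := GM GA.
  have mI (f : Omega -> R) : measurable_fun setT f ->
      measurable_fun A (EFin \o f).
    by move=> mf; apply/measurable_EFinP; exact: measurable_funTS.
  rewrite ge0_integralD//; last 3 first.
  - by apply: measurable_funTS; exact: meas_wrt_sub mgn.
  - by move=> w _; rewrite lee_fin.
  - by apply: mI; exact: mGT.
  have ma' : measurable_fun A (EFin \o a^\+%R) by apply: mI; exact: mGT.
  have mx' : measurable_fun A (EFin \o xi^\-%R) by apply: mI; exact: mneg.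
  have md' : measurable_fun A (EFin \o delta^\+%R) by apply: mI; exact: mpos.
  have e0 (f : Omega -> R) : (forall w, 0 <= f w)%R ->
      forall w, A w -> 0 <= (f w)%:E by move=> f0 w _; rewrite lee_fin.
  rewrite gnbE// gnE// -ge0_integralD//; try exact: e0.
  rewrite -ge0_integralD//; last 3 first.
  - by move=> w _; rewrite adde_ge0// lee_fin.
  - exact: emeasurable_funD.
  - exact: e0.
  apply: ae_ge0_le_integral => //.
  - by move=> w _; rewrite lee_fin.
  - by apply: mI; exact: mneg.
  - by move=> w _; rewrite !adde_ge0// lee_fin.
  - by apply: emeasurable_funD => //; exact: emeasurable_funD.
  apply: filterS le_ae => w le_w _; rewrite /= -!EFinD lee_fin.
  have le1 : (- xi w <= xi^\- w)%R by rewrite /funrneg le_max lexx.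
  have le2 : (a w <= a^\+ w)%R by rewrite /funrpos le_max lexx.
  have le3 : (delta w <= delta^\+ w)%R by rewrite /funrpos le_max lexx.
  rewrite {1}/funrneg ge_max !addr_ge0// andbT.
  have := le_w; move: le2; rewrite {1}/a; lra.
(* If gn = +oo then E = -oo and the right-hand side is +oo. If gn is finite then so is gnb by
   [step2]; an infinite gp forces an infinite gpb by [step1], and an infinite gpb makes the
   left-hand side -oo. Only the case of four finite values is arithmetic. *)
apply: filterS2 step1 step2 => w.
rewrite EE EbE; have := posneg a w; rewrite {1}/a.
move: (gp0 w) (gpb0 w) (gn0 w) (gnb0 w).
move: (gp w) (gpb w) (gn w) (gnb w) (a^\+%R w) (a^\-%R w).
move=> [p| |] [pb| |] [n| |] [nb| |] ap an //= p0 pb0 n0 nb0 aE;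
  rewrite ?(leey, leNye) //=.
- by rewrite -!EFinD !lee_fin; lra.
all: try by move=> _ /(_ (ltry _)).
Qed.

End CondExpComparison.

(** * Measurability of Stieltjes integrals in the path *)

Lemma measurable_fun_slice d1 d2 d3 (T1 : measurableType d1)
    (T2 : measurableType d2) (V : measurableType d3) (S : set (T1 * T2))
    (f : T1 * T2 -> V) (D : set T1) (w : T2) :
  measurable S -> measurable D -> (forall t, D t -> S (t, w)) ->
  measurable_fun S f -> measurable_fun D (fun t => f (t, w)).
Proof.
move=> mS mD DS mf _ B mB; have mSB := mf mS B mB.
have -> : D `&` (fun t => f (t, w)) @^-1` B = D `&` ysection (S `&` f @^-1` B) w.
  apply/seteqP; split => t; rewrite /ysection /= inE/=.
    by move=> [Dt fB]; split => //; split => //; exact: DS.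
  by move=> [? []].
by apply: measurableI => //; exact: measurable_ysection.
Qed.

Section StieltjesKernel.
Context (R : realType) (d : measure_display) (Omega : measurableType d).
Context (T : R) (A : Omega -> cumulative R R).
Hypothesis A_measurable : forall t, t <= T -> measurable_fun setT (fun w => A w t).

Local Open Scope ereal_scope.

Import HBNNSimple.

Lemma stieltjes_itvoc (f : cumulative R R) (a b : R) : (a <= b)%R ->
  lebesgue_stieltjes_measure f `]a, b]%classic = (f b - f a)%:E.
Proof.
move=> ab; rewrite /lebesgue_stieltjes_measure/= /measure_extension/=.
by rewrite measurable_mu_extE/= ?wlength_itv_bnd//; exact: is_ocitv.
Qed.

(* The restriction to ]-1, T] keeps the total masses finite; a left end point
   below 0 is what makes the half-open interval cover [0, T]. *)
Let D : set (measurableTypeR R) := `](-1)%R, T]%classic.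

Let mD : measurable D.
Proof. exact: measurable_itv. Qed.

Definition stieltjes_kernel (w : Omega) :
    {measure set (measurableTypeR R) -> \bar R} :=
  mrestr (lebesgue_stieltjes_measure (A w)) mD.

Let stieltjes_kernel_itvoc (a b : R) w :
  stieltjes_kernel w `]a, b]%classic =
  if (Num.max a (-1) <= Num.min b T)%R
  then (A w (Num.min b T) - A w (Num.max a (-1)))%:E else 0.
Proof.
rewrite /stieltjes_kernel /= /mrestr.
have -> : `]a, b]%classic `&` D = `]Num.max a (-1)%R, Num.min b T]%classic.
  apply/seteqP; split => x; rewrite /D /= !in_itv/= gt_max le_min.
    by move=> [/andP[-> ->] /andP[-> ->]].
  by move=> /andP[/andP[-> ->] /andP[-> ->]].
case: ifPn => [|]; first exact: stieltjes_itvoc.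
by rewrite -ltNge => h; rewrite set_itv_ge ?measure0// bnd_simp -leNgt ltW.
Qed.

Let measurable_kernel_itvoc (a b : R) :
  measurable_fun setT (fun w => stieltjes_kernel w `]a, b]%classic).
Proof.
under eq_fun do rewrite stieltjes_kernel_itvoc.
have [h|h] := leP (Num.max a (-1)%R) (Num.min b T); last exact: measurable_cst.
have hb : (Num.min b T <= T)%R by rewrite ge_min lexx orbT.
apply/measurable_EFinP; apply: measurable_funB; apply: A_measurable => //.
exact: le_trans h hb.
Qed.

Let kernel_fin w B : measurable B ->
  stieltjes_kernel w B < (`|A w T - A w (-1)| + 1)%:E.
Proof.
move=> mB; rewrite /stieltjes_kernel /= /mrestr.
have [h|h] := leP (-1)%R T.
  apply: (@le_lt_trans _ _ (A w T - A w (-1))%:E).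
    rewrite -stieltjes_itvoc//; apply: le_measure; rewrite ?inE//.
    exact: measurableI.
  by rewrite lte_fin (le_lt_trans (ler_norm _))// ltrDl.
rewrite /D set_itv_ge ?setI0 ?measure0 ?lte_fin ?ltr_wpDl//.
by rewrite bnd_simp -leNgt ltW.
Qed.

(** Dynkin induction from half-open intervals, whose mass is a difference of values of A at two
    times not exceeding T. The complement step subtracts masses, hence relies on their
    finiteness. *)
Lemma measurable_stieltjes_kernel (B : set (measurableTypeR R)) :
  measurable B -> measurable_fun setT (fun w => stieltjes_kernel w B).
Proof.
move: B; apply: (@dynkin_induction _ (measurableTypeR R) (@ocitv R)) => //.
- exact: ocitvI.
- under eq_fun do rewrite /stieltjes_kernel/= /mrestr setTI.
  have := measurable_kernel_itvoc (-1)%R T.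
  by under eq_fun do rewrite /stieltjes_kernel/= /mrestr setIid.
- by move=> _ [[a b] _ <-]; exact: measurable_kernel_itvoc.
- move=> S mS ih.
  have -> : (fun w => stieltjes_kernel w (~` S)) =
      (fun w => stieltjes_kernel w setT - stieltjes_kernel w S).
    apply/funext => w; rewrite -setTD measureD ?setTI//.
    by rewrite (lt_trans (kernel_fin _ _)) ?ltry.
  apply: emeasurable_funB => //.
  under eq_fun do rewrite /stieltjes_kernel/= /mrestr setTI.
  have := measurable_kernel_itvoc (-1)%R T.
  by under eq_fun do rewrite /stieltjes_kernel/= /mrestr setIid.
- move=> F mF tF ih.
  have -> : (fun w => stieltjes_kernel w (\bigcup_k F k)) =
      (fun w => \sum_(0 <= k <oo) stieltjes_kernel w (F k)).
    apply/funext => w; rewrite measure_bigcup//.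
    by apply: eq_eseriesl => k; rewrite in_setT.
  by apply: ge0_emeasurable_sum.
Qed.

HB.instance Definition _ := isKernel.Build _ _ _ _ _ stieltjes_kernel
  measurable_stieltjes_kernel.

Lemma measurable_stieltjes_integral (f : measurableTypeR R * Omega -> \bar R) :
  (forall x, 0 <= f x) -> measurable_fun (`[0%R, T]%classic `*` setT) f ->
  measurable_fun setT
    (fun w => \int[lebesgue_stieltjes_measure (A w)]_(t in `[0%R, T]) f (t, w)).
Proof.
move=> f0 mf.
have m0T : measurable (`[0%R, T]%classic : set (measurableTypeR R)).
  exact: measurable_itv.
pose g (x : Omega * measurableTypeR R) : \bar R :=
  (f \_ (`[0%R, T]%classic `*` setT)) (x.2, x.1).
have mg : measurable_fun setT g.
  apply: (measurableT_comp (f := f \_ (`[0%R, T]%classic `*` setT))).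
    by apply/(measurable_restrictT _ _).1 => //; exact: measurableX.
  exact: measurable_fun_pair measurable_snd measurable_fst.
have -> : (fun w => \int[lebesgue_stieltjes_measure (A w)]_(t in `[0%R, T]) f (t, w))
   = (fun w => \int[stieltjes_kernel w]_t g (w, t)).
  apply/funext => w.
  have D0T : `[0%R, T]%classic `<=` D.
    move=> t; rewrite /D /= !in_itv/= => /andP[t0 ->]; rewrite andbT.
    by rewrite (lt_le_trans _ t0)// ltrN10.
  transitivity (\int[stieltjes_kernel w]_(t in `[0%R, T]) f (t, w)).
    apply: eq_measure_integral => B mB BT.
    by rewrite /stieltjes_kernel/= /mrestr setIidl//; exact: subset_trans D0T.
  rewrite integral_mkcond; apply: eq_integral => t _.
  rewrite /g /patch /=; congr (if _ then _ else _).
  by apply/idP/idP; rewrite !inE /=; [|case].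
have key (S : set (Omega * measurableTypeR R)) : measurable S ->
    measurable_fun setT (fun w => stieltjes_kernel w (xsection S w)).
  move=> mS.
  (* The mass is finite for each outcome, but no bound uniform in w is available; the bound supplied
     here depends on w, and the added 1 makes it strict. *)
  have [w|_] := @measurable_prod_subset_xsection_kernel _ _ _ _ _
      stieltjes_kernel setT measurableT _ S mS.
    exists (`|A w T - A w (-1)| + 1)%R => X mX.
    by rewrite [ltLHS]/mrestr setIT; exact: kernel_fin.
  congr measurable_fun; apply/funext => w.
  by rewrite [LHS]/mrestr setIT.
pose g_ := nnsfun_approx measurableT mg.
apply: (@measurable_fun_xsection_integral _ _ _ _ _ _ _ g_).
- by move=> a b ab; exact/nd_nnsfun_approx.
- by move=> z; apply: cvg_nnsfun_approx => // x _; rewrite /g /patch; case: ifP.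
- by move=> n r; apply: key.
Qed.

End StieltjesKernel.

(** * Linearity of stochastic integrals *)

Section StochInt.
Context (R : realType) (d : measure_display) (Omega : measurableType d).
Context (P : probability Omega R) (T : R) (Ft : R -> set (set Omega)).
Hypothesis T0 : 0 <= T.
Hypothesis FtP : usual_filtration P T Ft.

Local Notation TS := (time_space T : set (measurableTypeR R * Omega)).

Lemma measurable_time_space : measurable TS.
Proof. by apply: measurableX => //; exact: measurable_itv. Qed.

Lemma pred_measurable_sub (C : set (pred_type T Ft)) :
  measurable C -> measurable (C : set (measurableTypeR R * Omega)).
Proof.
apply: smallest_sub; first exact: sigma_algebra_measurable.
have m0 t B : 0 <= t <= T -> Ft t B -> measurable B.
  by move=> tT; exact: (filt_sub FtP tT).
move=> _ [[B FB ->]|[u [v [B [u0 uv vT FB ->]]]]].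
  apply: measurableX; first exact: measurable_set1.
  by apply: m0 FB; rewrite lexx.
apply: measurableX; first exact: measurable_itv.
by apply: m0 FB; rewrite u0 (le_trans uv).
Qed.

Lemma pred_time_space : measurable (time_space T : set (pred_type T Ft)).
Proof.
have FtT t : 0 <= t <= T -> Ft t setT.
  move=> tT; have [F0 FC _] := filt_sigma FtP tT.
  by rewrite -(setD0 setT); exact: FC.
have -> : time_space T = ([set 0] `*` setT) `|`
    (`]0, T]%classic `*` setT) :> set (pred_type T Ft).
  apply/seteqP; split => -[t w]; rewrite /time_space /= !in_itv/=.
    move=> [/andP[]]; rewrite le_eqVlt => /orP[/eqP <-|t0 tT] _; first by left.
    by right; rewrite t0.
  by move=> [[-> _]|[/andP[/ltW -> ->]]//]; rewrite lexx.
apply: measurableU; apply: sub_sigma_algebra.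
  by left; exists setT => //; apply: FtT; rewrite lexx.
by right; exists 0, T, setT; split => //; apply: FtT; rewrite lexx.
Qed.

Lemma predictable_measurable (H : R -> Omega -> R) : predictable T Ft H ->
  measurable_fun TS (fun x => H x.1 x.2).
Proof.
move=> pH _ B mB; apply: pred_measurable_sub.
exact: (pH pred_time_space B mB).
Qed.

Lemma time_space_section d' (V : measurableType d')
    (f : measurableTypeR R * Omega -> V) (t : R) : 0 <= t <= T ->
  measurable_fun TS f -> measurable_fun setT (fun w => f (t, w)).
Proof.
move=> tT mf _ B mB; rewrite setTI.
have mS := mf measurable_time_space B mB.
have -> : (fun w => f (t, w)) @^-1` B =
    xsection (TS `&` f @^-1` B) t.
  apply/seteqP; split => w; rewrite /xsection /= inE/=.
    by move=> fB; split => //; split => //=; rewrite in_itv.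
  by move=> [].
exact: measurable_xsection.
Qed.

Lemma measurable_adapted (N : R -> Omega -> R) (t : R) :
  adapted T Ft N -> 0 <= t <= T -> measurable_fun setT (N t).
Proof.
move=> aN tT; apply: meas_wrt_sub (aN _ tT); exact: (filt_sub FtP).
Qed.

Lemma adaptedB (N N' : R -> Omega -> R) : adapted T Ft N -> adapted T Ft N' ->
  adapted T Ft (fun t w => N t w - N' t w).
Proof.
move=> aN aN' t tT; have sG := filt_sigma FtP tT.
apply/(meas_wrt_measurable_fun sG)/measurable_funB;
  apply/(meas_wrt_measurable_fun sG); [exact: aN|exact: aN'].
Qed.

Lemma cadlagB (f g : R -> R) : cadlag T f -> cadlag T g ->
  cadlag T (fun t => f t - g t).
Proof.
move=> [fr fl] [gr gl]; split => t tT; first by apply: cvgB; [exact: fr|exact: gr].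
by apply: is_cvgB; [exact: fl|exact: gl].
Qed.

(** The two lists of intervals are concatenated and the second family of coefficients is negated.
    Intervals of a simple integrand may overlap, so no common refinement has to be built. *)
Definition simple_sub (S S' : simple_integrand R Omega) :=
  @SimpleIntegrand R d Omega (s_size S + s_size S')%N
    (fun k => match fintype.split k with inl i => s_lo i | inr j => s_lo j end)
    (fun k => match fintype.split k with inl i => s_hi i | inr j => s_hi j end)
    (fun k => match fintype.split k with
       | inl i => s_coef i | inr j => fun w => - s_coef j w end).

Lemma simple_sub_predictable S S' : simple_predictable T Ft S ->
  simple_predictable T Ft S' -> simple_predictable T Ft (simple_sub S S').
Proof.
move=> pS pS' k; rewrite /=; case: splitP => j _; first exact: pS.
have [l0 lh hT mc [c cP]] := pS' j; split => //.
  have lT : 0 <= s_lo j <= T by rewrite l0 (le_trans lh).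
  have sG := filt_sigma FtP lT.
  apply/(meas_wrt_measurable_fun sG)/measurableT_comp => //.
  exact/(meas_wrt_measurable_fun sG).
by exists c => w; rewrite normrN.
Qed.

Lemma simple_sub_val S S' t w :
  simple_val (simple_sub S S') t w = simple_val S t w - simple_val S' t w.
Proof.
rewrite /simple_val big_split_ord /= -sumrN; congr (_ + _).
  by apply: eq_bigr => i _; rewrite (unsplitK (inl i)).
by apply: eq_bigr => i _; rewrite (unsplitK (inr i)) mulNr.
Qed.

Lemma simple_sub_int S S' M t w :
  simple_int (simple_sub S S') M t w = simple_int S M t w - simple_int S' M t w.
Proof.
rewrite /simple_int big_split_ord /= -sumrN; congr (_ + _).
  by apply: eq_bigr => i _; rewrite (unsplitK (inl i)).
by apply: eq_bigr => i _; rewrite (unsplitK (inr i)) mulNr.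
Qed.

Lemma measurable_simple_val S : simple_predictable T Ft S ->
  measurable_fun setT
    (fun x : measurableTypeR R * Omega => simple_val S x.1 x.2).
Proof.
move=> pS; apply: measurable_sum => k; have [l0 lh hT mc _] := pS k.
apply: measurable_funM.
  apply: (measurableT_comp (f := s_coef k)) => //.
  apply: meas_wrt_sub mc; apply: (filt_sub FtP).
  by rewrite l0 (le_trans lh).
have m1 : measurable_fun setT
    (indic (`]s_lo k, s_hi k]%classic : set (measurableTypeR R)) : _ -> R).
  by apply: measurable_indic; exact: measurable_itv.
exact: (measurableT_comp m1 measurable_fst).
Qed.

Lemma measurable_simple_int S M t : adapted T Ft M -> 0 <= t <= T ->
  simple_predictable T Ft S -> measurable_fun setT (simple_int S M t).
Proof.
move=> aM /andP[t0 tT] pS; apply: measurable_sum => k.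
have [l0 lh hT mc _] := pS k.
apply: measurable_funM.
  by apply: meas_wrt_sub mc; apply: (filt_sub FtP); rewrite l0 (le_trans lh).
apply: measurable_funB; apply: measurable_adapted => //.
  by rewrite le_min t0 (le_trans l0)//= ge_min tT.
by rewrite le_min t0 l0/= ge_min tT.
Qed.

Local Open Scope ereal_scope.

(** A substitute for the triangle inequality in L^2, free of square roots and valid for infinite
    integrals: the difference of the two integrands is (f + g)^2 >= 0. *)
Lemma le_integral_sqrB d' (U : measurableType d') (m : {measure set U -> \bar R})
    (D : set U) (f g : U -> R) : measurable D ->
  measurable_fun D f -> measurable_fun D g ->
  \int[m]_(x in D) ((f x - g x) ^+ 2)%:E <=
  2%:E * \int[m]_(x in D) (f x ^+ 2)%:E + 2%:E * \int[m]_(x in D) (g x ^+ 2)%:E.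
Proof.
move=> mD mf mg.
have m2 (h : U -> R) : measurable_fun D h ->
    measurable_fun D (fun x => (h x ^+ 2)%:E).
  by move=> mh; apply/measurable_EFinP; exact: measurable_funX.
have p2 (h : U -> R) x : D x -> 0 <= (h x ^+ 2)%:E.
  by rewrite lee_fin sqr_ge0.
rewrite -!ge0_integralZl//; try exact: m2; try exact: p2.
rewrite -ge0_integralD//; last 4 first.
- by move=> x _; rewrite mule_ge0// lee_fin sqr_ge0.
- by apply: measurable_funeM; exact: m2.
- by move=> x _; rewrite mule_ge0// lee_fin sqr_ge0.
- by apply: measurable_funeM; exact: m2.
apply: ge0_le_integral => //.
- exact: (p2 (fun x => f x - g x)%R).
- by apply: (m2 (fun x => f x - g x)%R); exact: measurable_funB.
- by apply: emeasurable_funD; apply: measurable_funeM; exact: m2.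
move=> x _; rewrite -!EFinM -EFinD lee_fin.
have := sqr_ge0 (f x + g x)%R; rewrite sqrrD sqrrB; lra.
Qed.

Lemma cvge0_le2 (u v w : nat -> \bar R) :
  (forall n, 0 <= w n) -> (forall n, w n <= 2%:E * u n + 2%:E * v n) ->
  u n @[n --> \oo] --> 0 -> v n @[n --> \oo] --> 0 -> w n @[n --> \oo] --> 0.
Proof.
move=> w0 wuv u0 v0.
have uv0 : 2%:E * u n + 2%:E * v n @[n --> \oo] --> 0.
  rewrite -[X in _ --> X](_ : 2%:E * 0 + 2%:E * 0 = 0); last by rewrite !mule0 adde0.
  by apply: cvgeD; rewrite ?mule0//; (rewrite -[X in _ --> X](mule0 2%:E); exact: cvgeZl).
apply: (squeeze_cvge _ (cvg_cst 0) uv0).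
by apply: nearW => n; rewrite w0 wuv.
Qed.

(** For each outcome this is the preceding quadratic bound; splitting the outer expectation is where
    measurability of the Stieltjes integral in w enters. *)
Lemma iterated_integral_sqrB (A : Omega -> cumulative R R)
    (f g : R -> Omega -> R) :
  (forall t, (t <= T)%R -> measurable_fun setT (fun w => A w t)) ->
  measurable_fun TS (fun x => f x.1 x.2) ->
  measurable_fun TS (fun x => g x.1 x.2) ->
  \int[P]_w \int[lebesgue_stieltjes_measure (A w)]_(t in `]0%R, T])
    ((f t w - g t w) ^+ 2)%:E <=
  2%:E * (\int[P]_w \int[lebesgue_stieltjes_measure (A w)]_(t in `]0%R, T])
    (f t w ^+ 2)%:E) +
  2%:E * (\int[P]_w \int[lebesgue_stieltjes_measure (A w)]_(t in `]0%R, T])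
    (g t w ^+ 2)%:E).
Proof.
move=> mA mf mg.
have mI (h : R -> Omega -> R) : measurable_fun TS (fun x => h x.1 x.2) ->
    measurable_fun setT (fun w =>
     \int[lebesgue_stieltjes_measure (A w)]_(t in `]0%R, T]) (h t w ^+ 2)%:E).
  move=> mh.
  (* The measurability result concerns integrals over [0, T]; extending the integrand by zero at
     time 0 turns the integral over ]0, T] into one of that kind. *)
  pose k (x : measurableTypeR R * Omega) :=
    ((fun x => (h x.1 x.2 ^+ 2)%:E) \_ (`]0%R, T]%classic `*` setT)) x.
  have := @measurable_stieltjes_integral _ _ _ T A mA k.
  have -> : (fun w => \int[lebesgue_stieltjes_measure (A w)]_(t in `[0%R, T])
       k (t, w)) = (fun w =>
     \int[lebesgue_stieltjes_measure (A w)]_(t in `]0%R, T]) (h t w ^+ 2)%:E).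
    apply/funext => w.
    rewrite -[in RHS](@setIidr _ `[0%R, T]%classic `]0%R, T]%classic); last first.
      by move=> t /=; rewrite !in_itv/= => /andP[/ltW -> ->].
    rewrite integral_mkcondr; apply: eq_integral => t _.
    rewrite /k /patch /=; congr (if _ then _ else _).
    by apply/idP/idP; rewrite !inE /=; [case|].
  apply.
    by move=> x; rewrite /k /patch; case: ifP => // _; rewrite lee_fin sqr_ge0.
  apply: measurable_funTS; apply/(measurable_restrictT _ _).1.
    by apply: measurableX => //; exact: measurable_itv.
  apply/measurable_EFinP; apply: measurable_funX.
  apply: measurable_funS mh; first exact: measurable_time_space.
  move=> x []; rewrite /time_space /= !in_itv/= => /andP[/ltW -> ->] _.
  by split.
have mS (h : R -> Omega -> R) w : measurable_fun TS (fun x => h x.1 x.2) ->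
    measurable_fun (`]0%R, T]%classic : set (measurableTypeR R)) (h ^~ w).
  move=> mh; apply: measurable_fun_slice mh => //.
  - exact: measurable_time_space.
  - by move=> t; rewrite /time_space /= !in_itv/= => /andP[/ltW -> ->].
have m0T : measurable (`]0%R, T]%classic : set (measurableTypeR R)).
  exact: measurable_itv.
have i0 (h : R -> Omega -> R) w : setT w ->
    0 <= \int[lebesgue_stieltjes_measure (A w)]_(t in `]0%R, T]) (h t w ^+ 2)%:E.
  by move=> _; apply: integral_ge0 => t _; rewrite lee_fin sqr_ge0.
rewrite -!ge0_integralZl//; try exact: mI; try exact: i0.
rewrite -ge0_integralD//; last 4 first.
- by move=> w _; rewrite mule_ge0// i0.
- by apply: measurable_funeM; exact: mI.
- by move=> w _; rewrite mule_ge0// i0.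
- by apply: measurable_funeM; exact: mI.
apply: ge0_le_integral => //.
- exact: (i0 (fun t w => f t w - g t w)%R).
- apply: (mI (fun t w => f t w - g t w)%R); exact: measurable_funB.
- by apply: emeasurable_funD; apply: measurable_funeM; exact: mI.
by move=> w _; apply: le_integral_sqrB => //; exact: mS.
Qed.

Lemma is_stoch_int_sub M (A : Omega -> cumulative R R) H H' N N' :
  adapted T Ft M ->
  (forall t, (t <= T)%R -> measurable_fun setT (fun w => A w t)) ->
  is_stoch_int P T Ft M A H N -> is_stoch_int P T Ft M A H' N' ->
  is_stoch_int P T Ft M A (fun t w => H t w - H' t w)%R
    (fun t w => N t w - N' t w)%R.
Proof.
move=> aM mA [pH aN cN [S [pS SH SN]]] [pH' aN' cN' [S' [pS' SH' SN']]].
split.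
- exact: measurable_funB.
- exact: adaptedB.
- by apply: filterS2 cN cN' => w; exact: cadlagB.
exists (fun n => simple_sub (S n) (S' n)); split.
- by move=> n; exact: simple_sub_predictable.
- apply: cvge0_le2 SH SH' => n.
    by apply: integral_ge0 => w _; apply: integral_ge0 => t _; rewrite lee_fin sqr_ge0.
  have mB U V : simple_predictable T Ft U -> predictable T Ft V ->
      measurable_fun TS (fun x => simple_val U x.1 x.2 - V x.1 x.2)%R.
    move=> pU pV; apply: measurable_funB; last exact: predictable_measurable.
    by apply: measurable_funTS; exact: measurable_simple_val.
  have := @iterated_integral_sqrB A (fun t w => simple_val (S n) t w - H t w)%R
    (fun t w => simple_val (S' n) t w - H' t w)%R mA (mB _ _ (pS n) pH)
    (mB _ _ (pS' n) pH').
  apply: le_trans; rewrite le_eqVlt; apply/orP; left; apply/eqP.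
  apply: eq_integral => w _; apply: eq_integral => t _.
  by rewrite simple_sub_val; congr ((_ ^+ 2)%:E); ring.
move=> t tT; apply: cvge0_le2 (SN t tT) (SN' t tT) => n.
  by apply: integral_ge0 => w _; rewrite lee_fin sqr_ge0.
have mB U V : simple_predictable T Ft U -> adapted T Ft V ->
    measurable_fun setT (fun w => simple_int U M t w - V t w)%R.
  move=> pU aV; apply: measurable_funB; first exact: measurable_simple_int.
  exact: measurable_adapted aV tT.
have := @le_integral_sqrB _ _ P setT _ _ measurableT (mB _ _ (pS n) aN)
  (mB _ _ (pS' n) aN').
apply: le_trans; rewrite le_eqVlt; apply/orP; left; apply/eqP.
apply: eq_integral => w _.
by rewrite simple_sub_int; congr ((_ ^+ 2)%:E); ring.
Qed.

(** Produces, from the integrals occurring in the two equations, a version of the integral of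
    [Z - Zb] to which condition (iii) applies. *)
Lemma is_stoch_int_sum_sub M (A : nat -> Omega -> cumulative R R) H H' J J' :
  (forall i, adapted T Ft (M i)) ->
  (forall i t, (t <= T)%R -> measurable_fun setT (fun w => A i w t)) ->
  is_stoch_int_sum P T Ft M A H J -> is_stoch_int_sum P T Ft M A H' J' ->
  is_stoch_int_sum P T Ft M A (fun i t w => H i t w - H' i t w)%R
    (fun t w => J t w - J' t w)%R.
Proof.
move=> aM mA [aJ cJ [N [NI NJ]]] [aJ' cJ' [N' [NI' NJ']]].
split.
- exact: adaptedB.
- by apply: filterS2 cJ cJ' => w; exact: cadlagB.
exists (fun i t w => N i t w - N' i t w)%R; split.
  by move=> i; exact: (is_stoch_int_sub (aM i) (mA i) (NI i) (NI' i)).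
move=> t tT; apply: cvge0_le2 (NJ t tT) (NJ' t tT) => n.
  by apply: integral_ge0 => w _; rewrite lee_fin sqr_ge0.
have mB (U : nat -> R -> Omega -> R) V : (forall i, adapted T Ft (U i)) ->
    adapted T Ft V ->
    measurable_fun setT (fun w => \sum_(i < n) U i t w - V t w)%R.
  move=> aU aV; apply: measurable_funB; last exact: measurable_adapted aV tT.
  by apply: measurable_sum => i; exact: measurable_adapted (aU i) tT.
have aN i : adapted T Ft (N i) by have [] := NI i.
have aN' i : adapted T Ft (N' i) by have [] := NI' i.
have := @le_integral_sqrB _ _ P setT _ _ measurableT (mB _ _ aN aJ)
  (mB _ _ aN' aJ').
apply: le_trans; rewrite le_eqVlt; apply/orP; left; apply/eqP.
apply: eq_integral => w _; rewrite sumrB; congr ((_ ^+ 2)%:E); ring.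
Qed.

End StochInt.

(** * The seminorm of the integrand along paths *)

Section BracketDensity.
Context (R : realType) (d : measure_display) (Omega : measurableType d).
Context (P : probability Omega R) (T : R) (Ft : R -> set (set Omega)).
Context (mu : {finite_measure set (measurableTypeR R) -> \bar R}).
Hypothesis T0 : 0 <= T.
Hypothesis FtP : usual_filtration P T Ft.

Local Notation TS := (time_space T : set (measurableTypeR R * Omega)).
Local Notation PT := (pred_type (Omega := Omega) T Ft).

Import HBNNSimple.
Local Open Scope ereal_scope.

Context (A : Omega -> cumulative R R) (h : R -> Omega -> R).
Hypothesis mA :
  forall t, (t <= T)%R -> measurable_fun setT (fun w => A w t).
Hypothesis hP : is_bracket_density P T Ft mu A h.

Let h_predictable : predictable T Ft h.
Proof. by case: hP => m1 [m2 [_ _ _ []]]. Qed.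

Let h_ge0 t w : (0 <= h t w)%R.
Proof. by case: hP => m1 [m2 [_ _ _ []]]. Qed.

Let mh : measurable_fun TS (fun x => (h x.1 x.2)%:E).
Proof.
by apply/measurable_EFinP; exact: (predictable_measurable T0 FtP h_predictable).
Qed.

Let mTS : measurable TS.
Proof. exact: measurable_time_space. Qed.

(** The left side is the mass that the absolutely continuous part m1 gives to C restricted to
    [0, T]; adding the singular part m2 can only increase it. *)
Lemma density_indic_le_bracket (C : set PT) : measurable C ->
  \int[(mu \x P)%E]_(x in TS) ((\1_C x)%:E * (h x.1 x.2)%:E) <=
  \int[P]_w \int[lebesgue_stieltjes_measure (A w)]_(t in `[0%R, T])
     (\1_C (t, w))%:E.
Proof.
move=> mC.
have mC' : measurable (C : set (measurableTypeR R * Omega)).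
  exact: (pred_measurable_sub T0 FtP mC).
case: (hP) => m1 [m2 [bE _ _ [_ _ m1E]]].
have pTS := pred_time_space T0 FtP.
have mD : measurable (C `&` (time_space T : set PT)) by exact: measurableI.
have -> : \int[(mu \x P)%E]_(x in TS) ((\1_C x)%:E * (h x.1 x.2)%:E) =
    m1 (C `&` time_space T).
  rewrite m1E//.
  have := @integral_mkcondl _ _ R (mu \x P)%E TS C (fun x => (h x.1 x.2)%:E).
  move=> ->; apply: eq_integral => x _.
  by rewrite patchE indicE; case: (x \in C); rewrite ?mul1e ?mul0e.
apply: (@le_trans _ _ (bracket_measure P A (C `&` time_space T))).
  by rewrite bE// leeDl.
rewrite le_eqVlt; apply/orP; left; apply/eqP.
apply: eq_integral => w _; apply: eq_integral => t; rewrite inE => tT.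
rewrite !indicE; congr ((_ : bool)%:R%:E); apply/idP/idP; rewrite !inE/=.
  by case.
by move=> ?; split.
Qed.

Lemma density_nnsfun_le_bracket (g : {nnsfun PT >-> R}) :
  \int[(mu \x P)%E]_(x in TS) ((g x)%:E * (h x.1 x.2)%:E) <=
  \int[P]_w \int[lebesgue_stieltjes_measure (A w)]_(t in `[0%R, T])
     (g (t, w))%:E.
Proof.
pose rs : seq R := finmap.enum_fset (fset_set (range g)).
pose C r : set PT := g @^-1` [set r].
have mC r : measurable (C r) by exact: measurable_sfunP.
have mC' r : measurable (C r : set (measurableTypeR R * Omega)).
  exact: (pred_measurable_sub T0 FtP (mC r)).
pose u r (x : measurableTypeR R * Omega) := r%:E * (\1_(C r) x)%:E.
have gE x : (g x)%:E = \sum_(r <- rs) u r x.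
  rewrite [g x in LHS]fimfunE fsbig_finite//= -sumEFin.
  by apply: eq_bigr => r _; rewrite EFinM.
have u0 r x : 0 <= u r x by exact: nnfun_muleindic_ge0.
have mu_ r : measurable_fun setT (u r).
  by apply: measurable_funeM; apply/measurable_EFinP; exact: measurable_indic.
have mI (B : set (measurableTypeR R * Omega)) : measurable B ->
    measurable_fun setT (fun w => \int[lebesgue_stieltjes_measure (A w)]_(t in `[0%R, T])
     (\1_B (t, w))%:E).
  move=> mB; apply: (@measurable_stieltjes_integral _ _ _ T A mA
    (fun x => (\1_B x)%:E)).
    by move=> x; rewrite lee_fin.
  by apply: measurable_funTS; apply/measurable_EFinP; exact: measurable_indic.
have mIu r : measurable_fun setT (fun w =>
    \int[lebesgue_stieltjes_measure (A w)]_(t in `[0%R, T]) (u r (t, w))).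
  apply: (@measurable_stieltjes_integral _ _ _ T A mA (u r)) => //.
  by apply: measurable_funTS; exact: mu_.
have m0T : measurable (`[0%R, T]%classic : set (measurableTypeR R)).
  exact: measurable_itv.
have mu2 r w : measurable_fun (`[0%R, T]%classic : set (measurableTypeR R))
    (fun t => u r (t, w)).
  by apply: measurable_funTS; exact: measurable_fun_pair1.
rewrite (eq_integral (fun x => \sum_(r <- rs)
    (u r x * (h x.1 x.2)%:E))); last first.
  move=> x _; rewrite gE ge0_sume_distrl//.
rewrite ge0_integral_sum//; last 2 first.
- by move=> r; apply: emeasurable_funM => //; apply: measurable_funTS; exact: mu_.
- by move=> r x _; rewrite mule_ge0// lee_fin.
rewrite [leRHS](eq_integral (fun w => \sum_(r <- rs)
   \int[lebesgue_stieltjes_measure (A w)]_(t in `[0%R, T]) u r (t, w))); last first.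
  move=> w _; rewrite -ge0_integral_sum//.
  by apply: eq_integral => t _; exact: gE.
rewrite ge0_integral_sum//; last first.
  by move=> r w _; exact: integral_ge0.
apply: lee_sum => r _.
(* The values r of a nonnegative function are nonnegative, but the sum is handled for arbitrary r; a
   negative r has an empty level set, so its term vanishes. For r >= 0 the factor comes out of both
   integrals. *)
have [r0|r0] := leP 0%R r; last first.
  have ux x : u r x = 0.
    by rewrite /u /C preimage_nnfun0// indic0 mule0.
  rewrite integral0_eq; last by move=> x _; rewrite ux mul0e.
  by apply: integral_ge0 => w _; exact: integral_ge0.
have -> : \int[(mu \x P)%E]_(x in TS) (u r x * (h x.1 x.2)%:E) =
    r%:E * \int[(mu \x P)%E]_(x in TS) ((\1_(C r) x)%:E * (h x.1 x.2)%:E).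
  rewrite -ge0_integralZl//.
  - by apply: eq_integral => x _; rewrite /u muleA.
  - apply: emeasurable_funM => //; apply: measurable_funTS.
    by apply/measurable_EFinP; exact: measurable_indic.
  - by move=> x _; rewrite mule_ge0// lee_fin.
have -> : \int[P]_w \int[lebesgue_stieltjes_measure (A w)]_(t in `[0%R, T]) u r (t, w) =
    r%:E * \int[P]_w \int[lebesgue_stieltjes_measure (A w)]_(t in `[0%R, T])
     (\1_(C r) (t, w))%:E.
  rewrite -ge0_integralZl//; last first.
  - by move=> w _; apply: integral_ge0 => t _; rewrite lee_fin.
  - exact: mI.
  apply: eq_integral => w _; rewrite -ge0_integralZl//.
  - apply: measurable_funTS; apply/measurable_EFinP.
    apply: (@measurable_fun_pair1 _ _ _ _ _ _ (\1_(C r) : _ -> R)).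
    exact: measurable_indic.
by apply: lee_wpmul2l => //; exact: density_indic_le_bracket.
Qed.

(** Approximation from below by predictable simple functions. Monotone convergence is used for mu x
    P only; on the bracket side each approximant is simply bounded by f, so no limit is taken under
    the random Stieltjes measures. *)
Lemma density_le_bracket (f : R -> Omega -> R) :
  predictable T Ft f -> (forall t w, (0 <= f t w)%R) ->
  \int[(mu \x P)%E]_(x in TS) (f x.1 x.2 * h x.1 x.2)%:E <=
  \int[P]_w \int[lebesgue_stieltjes_measure (A w)]_(t in `[0%R, T])
     (f t w)%:E.
Proof.
move=> pf f0.
pose g : PT -> \bar R := (fun x => (f x.1 x.2)%:E) \_ (time_space T : set PT).
have mg : measurable_fun setT g.
  apply/(measurable_restrictT _ _).1; first exact: (pred_time_space T0 FtP).
  exact/measurable_EFinP.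
have g0 x : 0 <= g x by rewrite /g patchE; case: ifP => // _; rewrite lee_fin.
pose g_ := nnsfun_approx measurableT mg.
have ndg : nondecreasing_seq (g_ : (PT -> R)^nat).
  by move=> a b ab; exact/nd_nnsfun_approx.
have cg x : (g_ n x)%:E @[n --> \oo] --> g x.
  by apply: cvg_nnsfun_approx => // y _.
have gle n x : (g_ n x)%:E <= g x by rewrite nnsfun_approxE; exact: le_approx.
have mg_ n : measurable_fun TS (fun x => (g_ n x)%:E).
  apply/measurable_EFinP => _ B mB.
  apply: measurableI => //; apply: (pred_measurable_sub T0 FtP).
  by rewrite -[X in measurable X]setTI; exact: measurable_funPT.
have -> : \int[(mu \x P)%E]_(x in TS) (f x.1 x.2 * h x.1 x.2)%:E =
    \int[(mu \x P)%E]_(x in TS) limn (fun n => (g_ n x)%:E * (h x.1 x.2)%:E).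
  apply: eq_integral => x; rewrite inE => xT; apply/esym/cvg_lim => //.
  rewrite (_ : (f x.1 x.2 * h x.1 x.2)%:E = g x * (h x.1 x.2)%:E).
    by apply: cvgeZr.
  by rewrite /g patchE mem_set.
rewrite monotone_convergence//; last 3 first.
- by move=> n; exact: emeasurable_funM.
- by move=> n x _; rewrite mule_ge0// lee_fin.
- move=> x _ a b ab; apply: lee_wpmul2r; rewrite lee_fin//.
  by have /lefP := ndg _ _ ab; apply.
apply: lime_le.
  apply: ereal_nondecreasing_is_cvgn => a b ab; apply: ge0_le_integral => //.
  - by move=> x _; rewrite mule_ge0// lee_fin.
  - exact: emeasurable_funM.
  - exact: emeasurable_funM.
  move=> x _; apply: lee_wpmul2r; rewrite lee_fin//.
  by have /lefP := ndg _ _ ab; apply.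
apply: nearW => n; apply: (le_trans (density_nnsfun_le_bracket (g_ n))).
have mf : measurable_fun TS (fun x => (f x.1 x.2)%:E).
  by apply/measurable_EFinP; exact: (predictable_measurable T0 FtP pf).
apply: ge0_le_integral => //.
- by move=> w _; apply: integral_ge0 => t _; rewrite lee_fin.
- apply: (@measurable_stieltjes_integral _ _ _ T A mA (fun x => (g_ n x)%:E)).
    by move=> x; rewrite lee_fin.
  exact: mg_.
- apply: (@measurable_stieltjes_integral _ _ _ T A mA (fun x => (f x.1 x.2)%:E)).
    by move=> x; rewrite lee_fin.
  exact: mf.
move=> w _.
have m0T : measurable (`[0%R, T]%classic : set (measurableTypeR R)).
  exact: measurable_itv.
have ms (k : measurableTypeR R * Omega -> \bar R) : measurable_fun TS k ->
    measurable_fun (`[0%R, T]%classic : set (measurableTypeR R)) (fun t => k (t, w)).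
  by move=> mk; apply: measurable_fun_slice mk.
apply: ge0_le_integral => //.
- by move=> t _; rewrite lee_fin.
- exact: (ms _ (mg_ n)).
- exact: (ms _ mf).
move=> t tT; apply: (le_trans (gle n (t, w))).
by rewrite /g patchE; case: ifP => // _; rewrite lee_fin.
Qed.

End BracketDensity.

Section PathwiseIntegrability.
Context (R : realType) (d : measure_display) (Omega : measurableType d).
Context (P : probability Omega R).
Context (mu : {finite_measure set (measurableTypeR R) -> \bar R}).

Local Open Scope ereal_scope.

Let patch_section (D : set (measurableTypeR R))
    (G : measurableTypeR R * Omega -> \bar R) w :
  \int[mu]_(t in D) G (t, w) = \int[mu]_t (G \_ (D `*` setT)) (t, w).
Proof.
rewrite integral_mkcond; apply: eq_integral => t _.
rewrite /patch /=; congr (if _ then _ else _).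
by apply/idP/idP; rewrite !inE /=; [|case].
Qed.

Lemma measurable_section_integral (D : set (measurableTypeR R))
    (G : measurableTypeR R * Omega -> \bar R) : measurable D ->
  (forall x, 0 <= G x) -> measurable_fun (D `*` setT) G ->
  measurable_fun setT (fun w => \int[mu]_(t in D) G (t, w)).
Proof.
move=> mD G0 mG; under eq_fun do rewrite patch_section.
apply: (measurable_fun_fubini_tonelli_G (G \_ (D `*` setT))).
  by apply/(measurable_restrictT _ _).1 => //; exact: measurableX.
by move=> x; rewrite patchE; case: ifP.
Qed.

Lemma ge0_integral_prod_section (D : set (measurableTypeR R))
    (G : measurableTypeR R * Omega -> \bar R) : measurable D ->
  (forall x, 0 <= G x) -> measurable_fun (D `*` setT) G ->
  \int[(mu \x P)%E]_(x in D `*` setT) G x =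
  \int[P]_w \int[mu]_(t in D) G (t, w).
Proof.
move=> mD G0 mG; rewrite integral_mkcond fubini_tonelli2.
- by apply: eq_integral => w _; rewrite /fubini_G patch_section.
- by apply/(measurable_restrictT _ _).1 => //; exact: measurableX.
- by move=> x; rewrite patchE; case: ifP.
Qed.

Lemma ae_section_integral_lty (D : set (measurableTypeR R))
    (G : measurableTypeR R * Omega -> \bar R) : measurable D ->
  (forall x, 0 <= G x) -> measurable_fun (D `*` setT) G ->
  \int[P]_w \int[mu]_(t in D) G (t, w) < +oo ->
  {ae P, forall w, \int[mu]_(t in D) G (t, w) < +oo}.
Proof.
move=> mD G0 mG Glt.
have W0 w : 0 <= \int[mu]_(t in D) G (t, w) by exact: integral_ge0.
have : P.-integrable setT (fun w => \int[mu]_(t in D) G (t, w)).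
  apply/integrableP; split; first exact: measurable_section_integral.
  by under eq_integral do rewrite gee0_abs//.
move=> /(integrable_ae measurableT); apply: filterS => w /(_ Logic.I).
by rewrite ge0_fin_numE.
Qed.

(** Tonelli applied to a measurable null set containing the exceptional set, so that [N] itself need
    not be measurable. *)
Lemma ae_section (N : measurableTypeR R * Omega -> Prop) :
  {ae (mu \x P)%E, forall x, N x} ->
  {ae P, forall w, {ae mu, forall t, N (t, w)}}.
Proof.
move=> [B [mB B0 NB]].
have : \int[P]_w \int[mu]_t (\1_B (t, w))%:E = 0.
  rewrite -(@fubini_tonelli2 _ _ _ _ _ mu P (EFin \o \1_B)).
  - by rewrite integral_indic// setIT.
  - by apply/measurable_EFinP; exact: measurable_indic.
  - by move=> x /=; rewrite lee_fin.
have iE w : \int[mu]_t (\1_B (t, w))%:E = mu (ysection B w).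
  exact: (congr1 (fun f => f w) (indic_fubini_tonelli_GE mu mB)).
under eq_integral do rewrite iE.
have mi : measurable_fun setT (fun w => mu (ysection B w)).
  exact: measurable_fun_ysection.
move=> i0; have : \int[P]_w `|mu (ysection B w)| = 0.
  by rewrite -[RHS]i0; apply: eq_integral => w _; rewrite gee0_abs.
move=> /(ae_eq_integral_abs _ measurableT mi); apply: filterS => w /(_ Logic.I) Bw0.
exists (ysection B w); split; [exact: measurable_ysection|exact: Bw0|].
by move=> t NN; rewrite /ysection /= inE; exact: NB.
Qed.

End PathwiseIntegrability.

Section ZNorm.
Context (R : realType) (d : measure_display) (Omega : measurableType d).
Context (P : probability Omega R) (T : R) (Ft : R -> set (set Omega)).
Context (mu : {finite_measure set (measurableTypeR R) -> \bar R}).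
Hypothesis T0 : 0 <= T.
Hypothesis FtP : usual_filtration P T Ft.
Context (A : nat -> Omega -> cumulative R R) (h : nat -> R -> Omega -> R).
Hypothesis mA : forall i t, t <= T -> measurable_fun setT (fun w => A i w t).
Hypothesis hP : forall i, is_bracket_density P T Ft mu (A i) (h i).

Local Notation TS := (time_space T : set (measurableTypeR R * Omega)).

Lemma enorm2_ge0 K (v : 'rV[R]_K) : 0 <= enorm2 v.
Proof. by apply: sumr_ge0 => j _; exact: sqr_ge0. Qed.

Lemma density_ge0 i t w : 0 <= h i t w.
Proof. by case: (hP i) => m1 [m2 [_ _ _ []]]. Qed.

Lemma density_predictable i : predictable T Ft (h i).
Proof. by case: (hP i) => m1 [m2 [_ _ _ []]]. Qed.

Local Open Scope ereal_scope.

Lemma znorm2_ge0 K t w (z : nat -> 'rV[R]_K) : 0 <= znorm2 h t w z.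
Proof.
apply: nneseries_ge0 => i _ _.
by rewrite lee_fin mulr_ge0 ?enorm2_ge0 ?density_ge0.
Qed.

Lemma predictable_enorm2 K (Y : R -> Omega -> 'rV[R]_K) :
  (forall j, predictable T Ft (fun t w => Y t w 0%R j)) ->
  predictable T Ft (fun t w => enorm2 (Y t w)).
Proof. by move=> pY; apply: measurable_sum => j; apply: measurable_funX; exact: pY. Qed.

Lemma measurable_znorm2 K (Z : nat -> R -> Omega -> 'rV[R]_K) :
  (forall i j, predictable T Ft (fun t w => Z i t w 0%R j)) ->
  measurable_fun TS (fun x => znorm2 h x.1 x.2 (fun i => Z i x.1 x.2)).
Proof.
move=> pZ; apply: ge0_emeasurable_sum => [i x _ _|i _].
  by rewrite lee_fin mulr_ge0 ?enorm2_ge0 ?density_ge0.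
apply/measurable_EFinP; apply: measurable_funM.
  exact: (predictable_measurable T0 FtP (predictable_enorm2 (pZ i))).
exact: (predictable_measurable T0 FtP (density_predictable i)).
Qed.

(** All terms are nonnegative, so the sum over the martingales can be pulled out of the integrals on
    both sides; the bound by the norm of H^2_M is then a statement about one bracket at a time. *)
Lemma ae_znorm2_integral_lty K (Z : nat -> R -> Omega -> 'rV[R]_K) :
  H2_M P T Ft A Z ->
  {ae P, forall w,
    \int[mu]_(t in `[0%R, T]) znorm2 h t w (fun i => Z i t w) < +oo}.
Proof.
move=> [pZ ZA].
have m0T : measurable (`[0%R, T]%classic : set (measurableTypeR R)).
  exact: measurable_itv.
have mn i := predictable_measurable T0 FtP (predictable_enorm2 (pZ i)).
have mhi i := predictable_measurable T0 FtP (density_predictable i).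
apply: (@ae_section_integral_lty _ _ _ P mu _
  (fun x => znorm2 h x.1 x.2 (fun i => Z i x.1 x.2))) => //.
- by move=> x; exact: znorm2_ge0.
- exact: measurable_znorm2.
rewrite -(@ge0_integral_prod_section _ _ _ P mu _
  (fun x => znorm2 h x.1 x.2 (fun i => Z i x.1 x.2)))//; last 2 first.
- by move=> x; exact: znorm2_ge0.
- exact: measurable_znorm2.
rewrite integral_nneseries//; last 3 first.
- exact: measurable_time_space.
- move=> i; apply/measurable_EFinP; exact: measurable_funM.
- by move=> i x _; rewrite lee_fin mulr_ge0 ?enorm2_ge0 ?density_ge0.
apply: le_lt_trans ZA; rewrite integral_nneseries//; last 2 first.
- move=> i; apply: (@measurable_stieltjes_integral _ _ _ T _ (mA i)
    (fun x => (enorm2 (Z i x.1 x.2))%:E)).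
    by move=> x; rewrite lee_fin enorm2_ge0.
  by apply/measurable_EFinP; exact: mn.
- by move=> i w _; apply: integral_ge0 => t _; rewrite lee_fin enorm2_ge0.
apply: lee_nneseries.
  move=> i _ _; apply: integral_ge0 => x _.
  by rewrite lee_fin mulr_ge0 ?enorm2_ge0 ?density_ge0.
move=> i _; apply: (density_le_bracket T0 FtP (mA i) (hP i)).
  exact: predictable_enorm2.
by move=> t w; exact: enorm2_ge0.
Qed.

End ZNorm.

(** * Integrability of the driver along paths *)

Section Cadlag.
Context (R : realType) (T : R).

(** The one-sided limits give a bound near each point, and compactness of [0, T] makes it uniform.
    At an end point the outward side contains no point of [0, T], and the bound 0 chosen there is
    vacuous. *)
Lemma cadlag_bounded (f : R -> R) : cadlag T f ->
  exists C : R, forall t, 0 <= t <= T -> `|f t| <= C.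
Proof.
move=> [fr fl].
have loc (x : R) : 0 <= x <= T -> exists M : R,
    \forall x' \near x, 0 <= x' <= T -> `|f x'| <= M.
  move=> /andP[x0 xT].
  have [Ml nl] : exists M : R, \forall x' \near x, 0 <= x' -> x' < x -> `|f x'| <= M.
    have [x00|x00] := ltP 0 x; last first.
      exists 0; apply: (@filterE _ (nbhs x) _) => x' x'0 x'x.
      by have := lt_le_trans x'x x00; rewrite ltNge x'0.
    have /cvg_ex[l fxl] : cvg (f u @[u --> x^'-]) by apply: fl; rewrite x00.
    exists (`|l| + 1).
    have : \forall u \near x^'-, `|l - f u| < 1 by apply: cvgr_dist_lt fxl _ ltr01.
    rewrite near_withinE; apply: filterS => u lu _ /lu{}lu.
    rewrite -[f u](subrK l) (le_trans (ler_normD _ _))// addrC lerD2l distrC.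
    exact: ltW.
  have [Mr nr] : exists M : R, \forall x' \near x, x' <= T -> x < x' -> `|f x'| <= M.
    have [xT'|xT'] := ltP x T; last first.
      exists 0; apply: (@filterE _ (nbhs x) _) => x' x'T x'x.
      by have := le_lt_trans xT' x'x; rewrite ltNge x'T.
    have fxl := fr x; rewrite x0 xT' in fxl; have {}fxl := fxl erefl.
    exists (`|f x| + 1).
    have : \forall u \near x^'+, `|f x - f u| < 1 by apply: cvgr_dist_lt fxl _ ltr01.
    rewrite near_withinE; apply: filterS => u lu _ /lu{}lu.
    rewrite -[f u](subrK (f x)) (le_trans (ler_normD _ _))// addrC lerD2l distrC.
    exact: ltW.
  exists (Num.max (`|f x|) (Num.max Ml Mr)).
  apply: filterS2 nl nr => x' ll rr /andP[x'0 x'T].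
  rewrite !le_max; have [xx|xx|->] := ltgtP x' x.
  - by rewrite ll ?orbT.
  - by rewrite rr ?orbT.
  - by rewrite lexx.
have := @segment_compact R 0 T; rewrite compact_near_coveringP.
move=> /(_ R +oo (fun M x => 0 <= x <= T -> `|f x| <= M) _) [].
  move=> x /=; rewrite in_itv/= => xT; have [M nM] := loc x xT.
  near=> x' M' => /= x'T.
  apply: (@le_trans _ _ M); first by move: x'T; near: x'.
  by near: M'; apply: nbhs_pinfty_ge; rewrite num_real.
(* The covering argument gives a bound for every number strictly above M, hence the shift by 1. *)
move=> M [_ MP]; exists (M + 1) => t tT.
by apply: (MP (M + 1)); rewrite ?ltrDl//= in_itv.
Unshelve. all: by end_near. Qed.

Lemma left_lim_bounded (f : R -> R) (C : R) (t : R) : cadlag T f ->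
  (forall u, 0 <= u <= T -> `|f u| <= C) -> 0 < t <= T ->
  `|lim (f u @[u --> t^'-])| <= C.
Proof.
move=> [_ fl] fC tT; have cf := fl t tT.
apply: (cvgr_to_le (cvg_norm cf)).
have [t0 tT'] := andP tT; near=> u; apply: fC; apply/andP; split.
    by near: u; exact: nbhs_left_ge.
  by apply: le_trans tT'; near: u; exact: nbhs_left_le.
Unshelve. all: by end_near. Qed.

(* A grid point strictly to the left of t, at distance at most 2/(n+1); it is
   capped at T so that the process is always evaluated inside [0, T]. *)
Definition left_step (n : nat) (t : R) : R :=
  Num.min ((Num.truncn (t * n.+1%:R)).-1%:R / n.+1%:R) T.

Lemma left_step_lt n t : 0 < t -> left_step n t < t.
Proof.
move=> t0; rewrite /left_step gt_min; apply/orP; left.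
rewrite ltr_pdivrMr//.
have /truncn_itv/andP[h _] : 0 <= t * n.+1%:R by rewrite mulr_ge0// ltW.
(* If the truncation is 0, its natural-number predecessor is again 0, and strictness comes from t >
   0; otherwise the predecessor loses one full grid step. *)
case: (Num.truncn _) h => [|m] h /=; first by rewrite mulr_gt0.
by rewrite (lt_le_trans _ h)// ltr_nat.
Qed.

Lemma left_step_gt n t : 0 < t <= T -> t - 2 / n.+1%:R <= left_step n t.
Proof.
move=> /andP[t0 tT]; rewrite /left_step le_min; apply/andP; split; last first.
  by rewrite (le_trans _ tT)// gerBl divr_ge0.
rewrite ler_pdivlMr// mulrBl divfK ?pnatr_eq0//.
have /truncn_itv/andP[_ h] : 0 <= t * n.+1%:R by rewrite mulr_ge0// ltW.
move: h; case: (Num.truncn _) => [|m] /=; rewrite ?mulrS; lra.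
Qed.

Lemma left_step_cvg t : 0 < t <= T -> left_step n t @[n --> \oo] --> t.
Proof.
move=> tT; have [t0 tT'] := andP tT.
have h1 : t - 2 / n.+1%:R @[n --> \oo] --> t.
  rewrite -[X in _ --> X]subr0; apply: cvgB; first exact: cvg_cst.
  rewrite -[X in _ --> X](mulr0 2); apply: cvgM; first exact: cvg_cst.
  exact: cvg_harmonic.
apply: (squeeze_cvgr _ h1 (cvg_cst t)).
by apply: nearW => n; rewrite left_step_gt//= ltW// left_step_lt.
Qed.

Lemma left_lim_step (f : R -> R) t : cadlag T f -> 0 < t <= T ->
  f (left_step n t) @[n --> \oo] --> lim (f u @[u --> t^'-]).
Proof.
move=> [_ fl] tT; have [t0 _] := andP tT.
apply: ((cvg_at_leftP _ _ _).1 (fl t tT)); split; last exact: left_step_cvg.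
by move=> n; exact: left_step_lt.
Qed.

End Cadlag.

Section LeftLimits.
Context (R : realType) (d : measure_display) (Omega : measurableType d).
Context (T : R).
Hypothesis T0 : 0 <= T.

(** The discretised process depends on time only through the grid cell containing t. Its preimages
    are countable unions of rectangles, so measurability at each fixed time already gives joint
    measurability. *)
Lemma measurable_left_step (N : R -> Omega -> R) n :
  (forall t, 0 <= t <= T -> measurable_fun setT (N t)) ->
  measurable_fun ((`]0, T]%classic : set (measurableTypeR R)) `*` setT)
    (fun x => N (left_step T n x.1) x.2).
Proof.
move=> mN _ B mB.
pose q (m : nat) : R := Num.min (m.-1%:R / n.+1%:R) T.
pose I m : set (measurableTypeR R) := `[m%:R / n.+1%:R, m.+1%:R / n.+1%:R[%classic.
have -> : (`]0, T]%classic `*` setT) `&`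
    (fun x : measurableTypeR R * Omega => N (left_step T n x.1) x.2) @^-1` B =
    \bigcup_m ((I m `&` `]0, T]%classic) `*` (N (q m) @^-1` B)).
  apply/seteqP; split => [[t w] [[/= tT _] NB]|[t w] [m _ [[/= tI tT] NB]]].
    exists (Num.truncn (t * n.+1%:R)) => //; split => //=; split => //.
    move: tT; rewrite /I /= !in_itv/= => /andP[t0 tT].
    have : 0 <= t * n.+1%:R by rewrite mulr_ge0// ltW.
    by move=> /truncn_itv; rewrite ler_pdivrMr// ltr_pdivlMr.
  split; first by split.
  rewrite /= /left_step (_ : Num.truncn _ = m)//.
  apply: truncn_def; move: tI; rewrite /I /= in_itv/=.
  by rewrite ler_pdivrMr// ltr_pdivlMr.
apply: bigcup_measurable => m _; apply: measurableX.
  by apply: measurableI; exact: measurable_itv.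
rewrite -[X in measurable X]setTI; apply: mN => //.
by rewrite /q le_min ge_min lexx orbT T0 divr_ge0.
Qed.

(** The left limit is the pointwise limit of the discretised processes, because [left_step]
    approaches t strictly from below. Convergence needs cadlag paths, hence the restriction to
    [E]. *)
Lemma measurable_left_lim K (Y : R -> Omega -> 'rV[R]_K) (E : set Omega) :
  (forall j t, 0 <= t <= T -> measurable_fun setT (fun w => Y t w 0 j)) ->
  measurable E -> (forall w, E w -> forall j, cadlag T (fun t => Y t w 0 j)) ->
  forall j, measurable_fun ((`]0, T]%classic : set (measurableTypeR R)) `*` E)
    (fun x => left_lim Y x.1 x.2 0 j).
Proof.
move=> mY mE cE j.
apply: (measurable_fun_cvg (h := fun n (x : measurableTypeR R * Omega) =>
  Y (left_step T n x.1) x.2 0 j)).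
  move=> n; apply: measurable_funS (measurable_left_step n (mY j)).
    by apply: measurableX => //; exact: measurable_itv.
  by move=> x [].
move=> [t w] [/= tT Ew]; move: tT; rewrite in_itv/= => tT.
have [t0 _] := andP tT.
rewrite /left_lim mxE leNgt t0/=.
exact: (left_lim_step (cE w Ew j) tT).
Qed.

End LeftLimits.

Section Driver.
Context (R : realType) (d : measure_display) (Omega : measurableType d).
Context (P : probability Omega R) (T : R) (Ft : R -> set (set Omega)).
Hypothesis T0 : 0 <= T.
Hypothesis FtP : usual_filtration P T Ft.

Local Notation TS := (time_space T : set (measurableTypeR R * Omega)).

(** The driver is composed with [phi], which records time, outcome and the values of y and z. It
    suffices to pull back the three kinds of generators, and predictable sets belong to the product
    sigma-algebra. *)
Lemma measurable_driver K (F : driver R Omega K)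
    (D : set (measurableTypeR R * Omega))
    (y : R -> Omega -> 'rV[R]_K) (z : nat -> R -> Omega -> 'rV[R]_K) :
  predictable_driver T Ft F -> measurable D -> D `<=` time_space T ->
  (forall j, measurable_fun D (fun x => y x.1 x.2 0 j)) ->
  (forall i j, measurable_fun D (fun x => z i x.1 x.2 0 j)) ->
  forall j, measurable_fun D
    (fun x => F x.2 x.1 (y x.1 x.2) (fun i => z i x.1 x.2) 0 j).
Proof.
move=> pF mD DT my mz j _ B mB.
pose phi (x : measurableTypeR R * Omega) : driver_args R Omega K :=
  ((x.1, x.2), (y x.1 x.2, fun i => z i x.1 x.2)).
have key C : <<s joint_gen (K := K) (pred_gen (Omega := Omega) T Ft) >> C ->
    measurable (D `&` phi @^-1` C).
  move: C; apply: smallest_sub => /=.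
    split.
    - by rewrite preimage_set0 setI0.
    - move=> C mC; rewrite setTD.
      have -> : D `&` phi @^-1` (~` C) = D `\` (D `&` phi @^-1` C).
        by rewrite setDIr setDv set0U preimage_setC setDE.
      exact: measurableD.
    - move=> C mC; rewrite preimage_bigcup setI_bigcupr.
      exact: bigcupT_measurable.
  move=> C [[G pG ->]|[k [G [mG ->]]]|[i [k [G [mG ->]]]]].
  - apply: measurableI => //.
    have -> : phi @^-1` [set x | G x.1] = G by apply/seteqP; split => -[].
    apply: (pred_measurable_sub T0 FtP); exact: sub_sigma_algebra.
  - exact: my.
  - exact: mz.
have -> : D `&` (fun x => F x.2 x.1 (y x.1 x.2) (fun i => z i x.1 x.2) 0 j) @^-1` B =
  D `&` phi @^-1` [set x | time_space T x.1 /\ B (F x.1.2 x.1.1 x.2.1 x.2.2 0 j)].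
  apply/seteqP; split => x [Dx].
    by move=> Bx; split => //; split => //=; have := DT _ Dx; case: x Dx Bx.
  by move=> [_].
apply: key; exact: pF.
Qed.

End Driver.

Section DriverPaths.
Context (R : realType) (d : measure_display) (Omega : measurableType d).
Context (P : probability Omega R) (T : R) (Ft : R -> set (set Omega)).
Context (mu : {finite_measure set (measurableTypeR R) -> \bar R}).
Hypothesis T0 : 0 <= T.
Hypothesis FtP : usual_filtration P T Ft.
Context (A : nat -> Omega -> cumulative R R) (h : nat -> R -> Omega -> R).
Hypothesis mA : forall i t, t <= T -> measurable_fun setT (fun w => A i w t).
Hypothesis hP : forall i, is_bracket_density P T Ft mu (A i) (h i).

Lemma negligible_measurable (N : set Omega) : P.-negligible N -> measurable N.
Proof.
move=> N0; apply: (filt_sub FtP) (filt_complete FtP N0).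
by rewrite lexx.
Qed.

(** On the exceptional set f is arbitrary, but every subset of a null set is measurable by
    completeness of the filtration. *)
Lemma measurable_ae_eq (E : set Omega) (f g : Omega -> R) :
  P.-negligible (~` E) -> (forall w, E w -> f w = g w) ->
  measurable_fun setT g -> measurable_fun setT f.
Proof.
move=> E0 fg mg _ B mB; rewrite setTI.
have mE : measurable E by rewrite -(setCK E); apply/measurableC/negligible_measurable.
have -> : f @^-1` B = (E `&` g @^-1` B) `|` (~` E `&` f @^-1` B).
  apply/seteqP; split => w /=.
    move=> Bf; have [Ew|nEw] := pselect (E w); [left|right] => //.
    by split => //; rewrite -fg.
  by move=> [[Ew]|[]//]; rewrite -fg.
apply: measurableU.
  by apply: measurableI => //; rewrite -[X in measurable X]setTI; exact: mg.
by apply: negligible_measurable; apply: negligibleS E0 => w [].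
Qed.

(** No integrability is required: the real integral is the finite part of a difference of two
    nonnegative integrals, each measurable in w by Tonelli. *)
Lemma measurable_section_Rintegral (D : set (measurableTypeR R))
    (f : measurableTypeR R * Omega -> R) : measurable D ->
  measurable_fun (D `*` setT) f ->
  measurable_fun setT (fun w => \int[mu]_(t in D) f (t, w)).
Proof.
move=> mD mf.
have mfE : measurable_fun (D `*` setT) (EFin \o f) by exact/measurable_EFinP.
apply: (measurableT_comp (f := fine)) => //.
under eq_fun do rewrite integralE.
have posE w : (\int[mu]_(t in D) (fun t => (f (t, w))%:E)^\+ t =
    \int[mu]_(t in D) (EFin \o f)^\+ (t, w))%E.
  by apply: eq_integral => t _; rewrite !funeposE.
have negE w : (\int[mu]_(t in D) (fun t => (f (t, w))%:E)^\- t =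
    \int[mu]_(t in D) (EFin \o f)^\- (t, w))%E.
  by apply: eq_integral => t _; rewrite !funenegE.
apply: emeasurable_funB; [under eq_fun do rewrite posE|under eq_fun do rewrite negE].
  exact: (measurable_section_integral mu mD (funepos_ge0 (EFin \o f))
    (measurable_funepos mfE)).
exact: (measurable_section_integral mu mD (funeneg_ge0 (EFin \o f))
  (measurable_funeneg mfE)).
Qed.

Context (K : nat) (F : driver R Omega K).
Context (Y : R -> Omega -> 'rV[R]_K) (Z : nat -> R -> Omega -> 'rV[R]_K).
Hypothesis F_std : standard_driver P T Ft mu h F.
Hypothesis Y_S2 : S2 P T Ft Y.
Hypothesis Z_H2 : H2_M P T Ft A Z.

Let E : set Omega := [set w | forall j, cadlag T (fun t => Y t w 0 j)].

Let E0 : P.-negligible (~` E).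
Proof. by case: Y_S2. Qed.

Let mE : measurable E.
Proof. by rewrite -(setCK E); apply/measurableC/negligible_measurable. Qed.

Let D : set (measurableTypeR R * Omega) := `]0, T]%classic `*` E.

Let mD : measurable D.
Proof. by apply: measurableX => //; exact: measurable_itv. Qed.

Let DT : D `<=` time_space T.
Proof.
by move=> [t w] []; rewrite /= /time_space/= !in_itv/= => /andP[/ltW-> ->].
Qed.

Let F_path j (x : measurableTypeR R * Omega) : R :=
  F x.2 x.1 (left_lim Y x.1 x.2) (fun i => Z i x.1 x.2) 0 j.

Let mF_path j : measurable_fun D (F_path j).
Proof.
apply: (measurable_driver (y := left_lim Y) T0 FtP (F_predictable F_std) mD DT).
  move=> k; apply: measurable_left_lim => //.
  have [aY _ _] := Y_S2.
  by move=> l t tT; exact: (measurable_adapted FtP (aY l) tT).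
have [pZ _] := Z_H2.
move=> i k; apply: measurable_funS (predictable_measurable T0 FtP (pZ i k)) => //.
exact: measurable_time_space.
Qed.

(** The integrand is replaced by 0 on the paths that are not cadlag, which changes the integral on a
    null set of outcomes only. *)
Lemma measurable_driver_integral (r : R) (j : 'I_K) : 0 <= r ->
  measurable_fun setT (fun w =>
    \int[mu]_(u in `]r, T]) F w u (left_lim Y u w) (fun i => Z i u w) 0 j).
Proof.
move=> r0; pose g := F_path j \_ D.
apply: (@measurable_ae_eq E _ (fun w => \int[mu]_(u in `]r, T]) g (u, w)) E0).
  move=> w Ew; apply: eq_Rintegral => u; rewrite inE => uT.
  rewrite /g patchE mem_set//; split => //=.
  by move: uT; rewrite /= !in_itv/= => /andP[/(le_lt_trans r0) -> ->].
apply: measurable_section_Rintegral; first exact: measurable_itv.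
by apply: measurable_funTS; apply/(measurable_restrictT _ _).1.
Qed.

Let F00 (x : measurableTypeR R * Omega) := enorm2 (F x.2 x.1 0 (fun _ => 0)).

Let mF00 : measurable_fun ((`]0, T]%classic : set (measurableTypeR R)) `*` setT) F00.
Proof.
apply: measurable_sum => j; apply: measurable_funX.
apply: (measurable_driver (y := fun _ _ => 0) (z := fun _ _ _ => 0) T0 FtP
  (F_predictable F_std)).
- by apply: measurableX => //; exact: measurable_itv.
- by move=> [t w] []; rewrite /= /time_space/= !in_itv/= => /andP[/ltW-> ->].
- by move=> k; exact: measurable_cst.
- by move=> i k; exact: measurable_cst.
Qed.

Lemma ae_driver_integrable : {ae P, forall w, forall j : 'I_K,
  mu.-integrable `]0, T]%classic (fun u =>
    (F w u (left_lim Y u w) (fun i => Z i u w) 0 j)%:E)}.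
Proof.
have m0T : measurable (`]0, T]%classic : set (measurableTypeR R)).
  exact: measurable_itv.
have ae1 : {ae P, forall w, E w} by exact: E0.
have ae2 : {ae P, forall w, (\int[mu]_(t in `]0%R, T]) (F00 (t, w))%:E < +oo)%E}.
  apply: (@ae_section_integral_lty _ _ _ P mu _ (EFin \o F00)) => //.
  - by move=> x; rewrite lee_fin enorm2_ge0.
  - exact/measurable_EFinP.
  - exact: (F_sq_integrable F_std).
have ae3 := ae_znorm2_integral_lty T0 FtP mA hP Z_H2.
have [c [ct [_ ctc _ /ae_section ae4]]] := F_lipschitz F_std.
apply: filterS3 (filterI ae1 ae2) ae3 ae4 => w [Ew F00w] Zw lipw j.
have mFw k : measurable_fun (`]0, T]%classic : set (measurableTypeR R))
    (fun u => F_path k (u, w)).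
  by apply: measurable_fun_slice (mF_path k) => //; split.
have mF00w : measurable_fun (`]0, T]%classic : set (measurableTypeR R))
    (fun u => F00 (u, w)).
  by apply: measurable_fun_slice mF00 => //; exact: measurableX.
have mZw : measurable_fun (`]0, T]%classic : set (measurableTypeR R))
    (fun u => znorm2 h u w (fun i => Z i u w)).
  have [pZ _] := Z_H2.
  apply: measurable_fun_slice (measurable_znorm2 T0 FtP hP pZ) => //.
    exact: measurable_time_space.
  by move=> u; rewrite /time_space /= !in_itv/= => /andP[/ltW-> ->].
have [C CP] : exists C : R, 0 <= C /\
    forall u, 0 < u <= T -> enorm2 (left_lim Y u w) <= C.
  have bnd (k : 'I_K) : exists M : R, forall t : R, 0 <= t <= T -> `|Y t w 0 k| <= M.
    exact: cadlag_bounded (Ew k).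
  have [M MP] : exists M : 'I_K -> R,
      forall k (t : R), 0 <= t <= T -> `|Y t w 0 k| <= M k.
    by exists (fun k => sval (cid (bnd k))) => k; exact: (svalP (cid (bnd k))).
  exists (\sum_(k < K) M k ^+ 2); split; first by apply: sumr_ge0 => k _; exact: sqr_ge0.
  move=> u uT; apply: ler_sum => k _.
  have h1 : `|left_lim Y u w 0 k| <= M k.
    have [u0 _] := andP uT; rewrite /left_lim mxE ifF; last first.
      by apply/negbTE; rewrite -ltNge.
    exact: (left_lim_bounded (Ew k) (MP k) uT).
  by rewrite -[leLHS]real_normK ?num_real// lerXn2r ?nnegrE// (le_trans _ h1).
(* With q the driver component along the path and q0 its value at y = 0, z = 0: |q| <= 1 + q^2 and
   q^2 <= 2 (q - q0)^2 + 2 q0^2, while the Lipschitz condition bounds (q - q0)^2 by |c| C + |c|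
   |Z|^2_M. The absolute value is there because c may be any real number. The constant part is
   integrable since mu is finite. *)
pose bound (u : measurableTypeR R) : \bar R :=
  ((1 + 2 * (`|c| * C))%:E + 2%:E * (F00 (u, w))%:E +
   (2 * `|c|)%:E * znorm2 h u w (fun i => Z i u w))%E.
have z0 u : (0 <= znorm2 h u w (fun i => Z i u w))%E by exact: (znorm2_ge0 hP).
have c0 : 0 <= 1 + 2 * (`|c| * C) by rewrite addr_ge0// !mulr_ge0//; case: CP.
have mb1 : measurable_fun (`]0, T]%classic : set (measurableTypeR R))
    (fun u => (1 + 2 * (`|c| * C))%:E + 2%:E * (F00 (u, w))%:E)%E.
  apply: emeasurable_funD; first exact: measurable_cst.
  by apply: measurable_funeM; exact/measurable_EFinP.
have b0 u : (0 <= bound u)%E.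
  by rewrite !adde_ge0// ?mule_ge0// lee_fin// ?mulr_ge0// enorm2_ge0.
have mbound : measurable_fun (`]0, T]%classic : set (measurableTypeR R)) bound.
  by apply: emeasurable_funD => //; exact: measurable_funeM.
have Fj_int : (\int[mu]_(u in `]0%R, T]) bound u < +oo)%E.
  rewrite ge0_integralD//; last 3 first.
  - by move=> u _; rewrite adde_ge0// ?mule_ge0// lee_fin// enorm2_ge0.
  - by move=> u _; rewrite mule_ge0// lee_fin mulr_ge0.
  - exact: measurable_funeM.
  rewrite ge0_integralD//; last 2 first.
  - by move=> u _; rewrite mule_ge0// lee_fin enorm2_ge0.
  - by apply: measurable_funeM; exact/measurable_EFinP.
  rewrite !ge0_integralZl//; last 2 first.
  - exact/measurable_EFinP.
  - by move=> u _; rewrite lee_fin enorm2_ge0.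
  apply: lte_add_pinfty; first apply: lte_add_pinfty.
  - rewrite (@integral_cst _ _ _ mu _ m0T (1 + 2 * (`|c| * C))%:E).
    apply: lte_mul_pinfty; rewrite ?lee_fin//.
    by rewrite -ge0_fin_numE//; exact: fin_num_measure.
  - by apply: lte_mul_pinfty.
  - apply: lte_mul_pinfty; rewrite ?lee_fin ?mulr_ge0//.
    apply: le_lt_trans Zw; apply: ge0_subset_integral => //.
    + have [pZ _] := Z_H2.
      by apply: measurable_fun_slice (measurable_znorm2 T0 FtP hP pZ) => //;
        exact: measurable_time_space.
    + by move=> u /=; rewrite !in_itv/= => /andP[/ltW -> ->].
apply/integrableP; split; first by apply/measurable_EFinP; exact: mFw.
apply: le_lt_trans Fj_int; apply: ae_ge0_le_integral => //.
  by apply: measurableT_comp => //; apply/measurable_EFinP; exact: mFw.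
apply: filterS lipw => u /= lipu uT0.
have uT : 0 < u <= T by move: uT0; rewrite in_itv.
have uT' : 0 <= u <= T by have /andP[/ltW-> ->] := uT.
have := lipu uT' (left_lim Y u w) 0 (fun i => Z i u w) (fun _ => 0).
rewrite (_ : (fun i => Z i u w - 0) = (fun i => Z i u w)); last first.
  by apply/funext => i; rewrite subr0.
rewrite subr0 /bound (EFinM 2 `|c|) -(muleA 2%:E).
have : (c%:E * znorm2 h u w (fun i => Z i u w) <=
    `|c|%:E * znorm2 h u w (fun i => Z i u w))%E.
  by apply: lee_wpmul2r => //; rewrite lee_fin ler_norm.
have : (0 <= `|c|%:E * znorm2 h u w (fun i => Z i u w))%E by rewrite mule_ge0.
(* Where the seminorm term is infinite the bound is +oo and nothing has to be shown; elsewhere the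
   rest is real arithmetic. *)
move: (`|c|%:E * _)%E => [s| |] //; last first.
  by move=> _ _ _; rewrite gt0_muley ?lte_fin// addey// leey.
rewrite lee_fin => s0 cs lip.
have {cs}lip : enorm2 (F w u (left_lim Y u w) (fun i => Z i u w) - F w u 0 (fun=> 0))
    <= `|c| * C + s.
  rewrite -lee_fin; apply: (le_trans lip); rewrite EFinD leeD// lee_fin.
  have [C0 CP'] := CP; apply: (@le_trans _ _ (`|c| * enorm2 (left_lim Y u w))).
    by rewrite ler_wpM2r ?enorm2_ge0// (le_trans (ctc _ uT'))// ler_norm.
  by rewrite ler_wpM2l// CP'.
have le_enorm2 (v : 'rV[R]_K) : v 0 j ^+ 2 <= enorm2 v.
  by rewrite /enorm2 (bigD1 j)//= lerDl; apply: sumr_ge0 => k _; exact: sqr_ge0.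
rewrite -!EFinM -!EFinD lee_fin.
have h1 := le_trans (le_enorm2 _) lip; rewrite !mxE in h1.
have h2 : F w u 0 (fun=> 0) 0 j ^+ 2 <= F00 (u, w) by exact: le_enorm2.
move: h1 h2; set q0 := F w u 0 (fun=> 0) 0 j.
set q := F w u (left_lim Y u w) _ 0 j => h1 h2.
(* [h3] yields 2 |q| <= 1 + q^2, and [h5] is q^2 <= 2 (q - q0)^2 + 2 q0^2 rearranged. *)
have h3 : 0 <= (`|q| - 1) ^+ 2 by exact: sqr_ge0.
have h4 : `|q| ^+ 2 = q ^+ 2 by rewrite real_normK// num_real.
have h5 := sqr_ge0 (q - 2 * q0).
have h6 := sqr_ge0 q.
move: h1 h2 h3 h4 h5 h6; rewrite !expr2; nra.
Qed.

End DriverPaths.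

(** * Comparison *)

Lemma ae_null_dominates (R : realType) (d : measure_display)
    (T : measurableType d) (m1 m2 : {measure set T -> \bar R}) (p : T -> Prop) :
  m1 `<< m2 -> {ae m2, forall x, p x} -> {ae m1, forall x, p x}.
Proof.
move=> /null_content_dominatesP m12 [N [mN N0 pN]].
by exists N; split => //; exact: m12.
Qed.

(** The order is assumed only almost everywhere: g - f agrees almost everywhere with its absolute
    value, whose integral is nonnegative. *)
Lemma ae_le_Rintegral (R : realType) (d : measure_display)
    (T : measurableType d) (mu : {measure set T -> \bar R}) (D : set T)
    (f g : T -> R) : measurable D ->
  mu.-integrable D (EFin \o f) -> mu.-integrable D (EFin \o g) ->
  {ae mu, forall x, D x -> f x <= g x} ->
  \int[mu]_(x in D) f x <= \int[mu]_(x in D) g x.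
Proof.
move=> mD fi gi fg; rewrite -subr_ge0 -RintegralB//.
have mgf : measurable_fun D (fun x => g x - f x).
  apply: measurable_funB; apply/measurable_EFinP;
    [exact: measurable_int gi|exact: measurable_int fi].
rewrite /Rintegral (@ae_eq_integral _ _ _ mu D (fun x => `|g x - f x|%:E))//.
- by apply: fine_ge0; apply: integral_ge0 => x _; rewrite lee_fin.
- exact/measurable_EFinP.
- by apply/measurable_EFinP; exact: measurableT_comp.
by apply: filterS fg => x fg /fg h; rewrite ger0_norm// subr_ge0.
Qed.
Theorem theorem7p1 (R : realType) (d : measure_display)
  (Omega : measurableType d) (P : probability Omega R)
  (T : R) (K : nat) (Ft : R -> set (set Omega))
  (mu : {finite_measure set (measurableTypeR R) -> \bar R})
  (M : nat -> R -> Omega -> R)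
  (A : nat -> Omega -> cumulative R R)
  (h : nat -> R -> Omega -> R)
  (setting : bsde_setting P T Ft mu M A h)
  (F Fb : driver R Omega K) (Q Qb : Omega -> 'rV[R]_K)
  (Y Yb : R -> Omega -> 'rV[R]_K) (Z Zb : nat -> R -> Omega -> 'rV[R]_K)
  (F_std : standard_driver P T Ft mu h F)
  (Fb_std : standard_driver P T Ft mu h Fb)
  (Q_L2 : terminal_value P T Ft Q)
  (Qb_L2 : terminal_value P T Ft Qb)
  (sol : bsde_solution P T Ft mu M A F Q Y Z)
  (solb : bsde_solution P T Ft mu M A Fb Qb Yb Zb)
  (s : R) (s_range : 0 <= s <= T)
  (cond_i : {ae P, forall w, forall j, Qb w 0 j <= Q w 0 j})
  (cond_ii : {ae (mu \x P)%E, forall x, s <= x.1 <= T -> forall j,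
    Fb x.2 x.1 (left_lim Yb x.1 x.2) (fun i => Zb i x.1 x.2) 0 j
    <= F x.2 x.1 (left_lim Yb x.1 x.2) (fun i => Zb i x.1 x.2) 0 j})
  (Pt : 'I_K -> probability Omega R)
  (Pt_equiv : forall j, Pt j `<< P /\ P `<< Pt j)
  (cond_iii : forall (j : 'I_K) (J : R -> Omega -> R),
    is_stoch_int_sum P T Ft M A (fun i t w => (Z i t w - Zb i t w) 0 j) J ->
    supermartingale_on T Ft (Pt j) s (fun r w =>
      - (\int[mu]_(u in `]s, r])
           ((F w u (left_lim Yb u w) (fun i => Z i u w)
             - F w u (left_lim Yb u w) (fun i => Zb i u w)) 0 j))
      + (J r w - J s w)))
  (cond_iv :
    (forall (r : R) (i : 'I_K) (E Eb : Omega -> \bar R), s <= r <= T ->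
      is_cond_exp (Pt i) (Ft r)
        (fun w => \int[mu]_(u in `]r, T])
           (F w u (left_lim Y u w) (fun k => Z k u w) 0 i)) E ->
      is_cond_exp (Pt i) (Ft r)
        (fun w => \int[mu]_(u in `]r, T])
           (F w u (left_lim Yb u w) (fun k => Z k u w) 0 i)) Eb ->
      {ae P, forall w,
        ((Yb r w 0 i)%:E - Eb w <= (Y r w 0 i)%:E - E w)%E}) ->
    {ae P, forall w, forall r, s <= r <= T -> forall j,
      Yb r w 0 j <= Y r w 0 j}) :
  {ae P, forall w, forall r, s <= r <= T -> forall j,
    Yb r w 0 j <= Y r w 0 j}.

Proof.
have T0 : 0 <= T := ltW (T_gt0 setting).
have FtP := filtP setting.
have hP := h_density setting.
(* On [0, T] this comes from predictability of the bracket, by taking a section at time t; at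
   nonpositive times the bracket is 0 by normalisation. *)
have mA i t : t <= T -> measurable_fun setT (fun w => A i w t).
  move=> tT; have [[pA _ _ _] A0] := M_bracket setting i.
  have [t0|t0] := leP t 0.
    by under eq_fun do rewrite A0//; exact: measurable_cst.
  have := @time_space_section _ _ _ T _ _ (fun x => A i x.2 x.1) t.
  by apply; [rewrite ltW|exact: (predictable_measurable T0 FtP pA)].
have aM i : adapted T Ft (M i) by have [[]] := M_martingale setting i.
have [Y_S2 Z_H2 [J [JP Y_eq]]] := sol.
have [Yb_S2 Zb_H2 [Jb [JbP Yb_eq]]] := solb.
have int2 := ae_driver_integrable T0 FtP mA hP F_std Yb_S2 Z_H2.
have int3 := ae_driver_integrable T0 FtP mA hP F_std Yb_S2 Zb_H2.
have int4 := ae_driver_integrable T0 FtP mA hP Fb_std Yb_S2 Zb_H2.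
(* The premise of (iv) concerns one time r and one component j at a time, so the null set may depend
   on r; simultaneity in r is part of what (iv) delivers. *)
apply: cond_iv => r j E Eb srT EP EbP.
have [s0 sT] := andP s_range; have [sr rT] := andP srT.
have r0 : 0 <= r := le_trans s0 sr.
have rT' : 0 <= r <= T by rewrite r0.
have sG := filt_sigma FtP rT'; have GM := filt_sub FtP rT'.
pose dJ t w := J j t w - Jb j t w.
have dJP : is_stoch_int_sum P T Ft M A (fun i t w => (Z i t w - Zb i t w) 0 j) dJ.
  have -> : (fun i t w => (Z i t w - Zb i t w) 0 j) =
      (fun i t w => Z i t w 0 j - Zb i t w 0 j).
    by apply/funext => i; apply/funext => t; apply/funext => w; rewrite !mxE.
  exact: is_stoch_int_sum_sub.
move: (cond_iii j dJ dJP); set X := (X in supermartingale_on _ _ _ _ X).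
move=> [mX iX X_super].
have [PtP PPt] := Pt_equiv j.
(* The goal is moved from P to [Pt j], under which the conditional expectations are formed; the
   pathwise inequality left over is moved back to P, where the two equations hold. *)
apply: (ae_null_dominates PPt).
pose delta w := X T w - X r w.
apply: (cond_exp_comparison sG GM (delta := delta) _ _ _ _ _ _ _ EP EbP).
- exact: (measurable_driver_integral T0 FtP F_std Y_S2 Z_H2 j r0).
- exact: (measurable_driver_integral T0 FtP F_std Yb_S2 Z_H2 j r0).
- by have [aY _ _] := Y_S2; exact: aY.
- by have [aY _ _] := Yb_S2; exact: aY.
- have := integrableB measurableT (iX T _) (iX r srT).
  by apply; rewrite sT lexx.
- move=> B GB; have mB := GM _ GB.
  have iB t : s <= t <= T -> (Pt j).-integrable B (EFin \o X t).
    by move=> tT; exact: integrableS (iX t tT).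
  have sTT : s <= T <= T by rewrite sT lexx.
  rewrite /delta; under eq_integral do rewrite EFinB.
  rewrite integralB_EFin//; [|exact: iB..].
  rewrite leeBlDr ?add0e; first exact: X_super.
  exact: (integrable_fin_num mB (iB r srT)).
apply: (ae_null_dominates PtP).
have lt_j := ae_section cond_ii.
apply: filterS3 (filterI (filterI cond_i lt_j) (filterI Y_eq Yb_eq)) int2
  (filterI int3 int4).
move=> w [[Qle Fle] [Yw Ybw]] i2 [i3 i4].
have {}Qle := Qle j; have {}Yw := Yw r rT' j; have {}Ybw := Ybw r rT' j.
have {}i2 := i2 j; have {}i3 := i3 j; have {}i4 := i4 j.
have mI a b : measurable (`]a, b]%classic : set (measurableTypeR R)).
  exact: measurable_itv.
have sub a b : 0 <= a -> b <= T ->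
    `]a, b]%classic `<=` (`]0, T]%classic : set (measurableTypeR R)).
  move=> a0 bT u /=; rewrite !in_itv/= => /andP[au ub].
  by rewrite (le_lt_trans a0 au) (le_trans ub bT).
have iS a b (g : measurableTypeR R -> R) : 0 <= a -> b <= T ->
    mu.-integrable `]0, T]%classic (fun u => (g u)%:E) ->
    mu.-integrable `]a, b]%classic (EFin \o g).
  by move=> a0 bT; apply: integrableS => //; exact: sub.
pose f2 u := F w u (left_lim Yb u w) (fun i => Z i u w) 0 j.
pose f3 u := F w u (left_lim Yb u w) (fun i => Zb i u w) 0 j.
pose f4 u := Fb w u (left_lim Yb u w) (fun i => Zb i u w) 0 j.
have XE t : X t w = - (\int[mu]_(u in `]s, t]) (f2 u - f3 u)) + (dJ t w - dJ s w).
  by rewrite /X; congr (- _ + _); apply: eq_Rintegral => u _; rewrite !mxE.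
have i23 a b : 0 <= a -> b <= T ->
    mu.-integrable `]a, b]%classic (EFin \o (fun u => f2 u - f3 u)).
  move=> a0 bT; have := integrableB (mI a b) (iS a b f2 a0 bT i2) (iS a b f3 a0 bT i3).
  by apply: eq_integrable => // u _.
(* X accumulates from s, but delta involves ]r, T] only: after the splitting the contributions of
   ]s, r] cancel. *)
have split_int : \int[mu]_(u in `]s, T]) (f2 u - f3 u) =
    \int[mu]_(u in `]s, r]) (f2 u - f3 u) + \int[mu]_(u in `]r, T]) (f2 u - f3 u).
  have itvU : `]s, T]%classic = `]s, r]%classic `|` `]r, T]%classic :> set R.
    apply/seteqP; split => u /=; rewrite !in_itv/=.
      move=> /andP[su uT]; have [ur|ur] := leP u r; first by left; rewrite su.
      by right.
    move=> [/andP[-> ur]|/andP[ru ->]]; first exact: le_trans ur rT.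
    by rewrite (le_lt_trans sr ru).
  rewrite itvU Rintegral_setU//.
    by rewrite -itvU; exact: i23.
  apply/disj_setPS => u [] /=; rewrite !in_itv/= => /andP[_ ur] /andP[ru _].
  by have := le_lt_trans ur ru; rewrite ltxx.
have I23 : \int[mu]_(u in `]r, T]) (f2 u - f3 u) =
    \int[mu]_(u in `]r, T]) f2 u - \int[mu]_(u in `]r, T]) f3 u.
  by apply: RintegralB => //; exact: iS.
have I43 : \int[mu]_(u in `]r, T]) f4 u <= \int[mu]_(u in `]r, T]) f3 u.
  apply: ae_le_Rintegral => //; [exact: iS|exact: iS|].
  apply: filterS Fle => u Fle /=; rewrite in_itv/= => /andP[ru uT].
  by apply: Fle; rewrite /= uT (le_trans sr (ltW ru)).
(* The integral of [f2] cancels between the left-hand side and delta. What remains is Qb + int_r^T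
   f4 - int_r^T f3 <= Q, the increments of J and Jb having been eliminated through the equations.
   The integral of F(Y_-, Z) appears identically in the equation for Y and in the goal, and so stays
   an opaque number [I1]. *)
rewrite /delta !XE split_int I23 /dJ.
move: Yw Ybw I43 Qle; rewrite -/f4.
set I1 := \int[mu]_(u in `]r, T]) F w u (left_lim Y u w) _ 0 j.
lra.
Qed.
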